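(* Let $(R,\mathfrak m,k)$ be a Noetherian local ring which is a homomorphic image of a Cohen–Macaulay local ring, and let $M$ be a finitely generated $R$-module of dimension $d>0$. If $\underline{x}=x_1,\dots,x_d$ and $\underline{y}=y_1,\dots,y_d$ are two $C$-systems of parameters of $M$, then $\mathrm{ir}_M(\underline{x})=\mathrm{ir}_M(\underline{y})$. That is, the index of reducibility $\mathrm{ir}_M(\underline{x})$ of the ideal $(\underline{x})$ on $M$ does not depend on the choice of the $C$-system of parameters $\underline{x}$.
   Context: For a finitely generated $R$-module $N$ and an ideal $\mathfrak q$ generated by a system of parameters of $N$, the index of reducibility $\mathrm{ir}_N(\mathfrak q)$ is the number of irreducible components in an irredundant irreducible decomposition of the submodule $\mathfrak qN$ of $N$; equivalently $\mathrm{ir}_N(\mathfrak q)=\dim_k \mathrm{Soc}(N/\mathfrak q N)$, where $\mathrm{Soc}(L)=0:_L\mathfrak m$. For a system of parameters $\underline{x}$ we write $\mathrm{ir}_N(\underline{x})=\mathrm{ir}_N((\underline{x}))$. For a finitely generated $R$-module $N$ of dimension $s>0$, define $\mathfrak b(N)=\bigcap \mathrm{Ann}_R\big(0:_{N/(z_1,\dots,z_{i-1})N} z_i\big)$, the intersection taken over all systems of parameters $z_1,\dots,z_s$ of $N$ and all $i=1,\dots,s$. A system of parameters $x_1,\dots,x_d$ of $M$ is a $C$-system of parameters of $M$ if $x_d\in\mathfrak b(M)^3$ and $x_i\in\mathfrak b(M/(x_{i+1},\dots,x_d)M)^3$ for all $i=d-1,\dots,1$. *)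

(* Defs.v *)
From HB Require Import structures.
From mathcomp Require Import all_boot all_order all_algebra.
Set Implicit Arguments. Unset Strict Implicit. Unset Printing Implicit Defensive.
Import GRing.Theory.
Local Open Scope ring_scope.

Section CommAlg.
Variable R : comNzRingType.

Definition ideal (I : R -> Prop) : Prop :=
  [/\ I 0, (forall a b, I a -> I b -> I (a + b)) & (forall r a, I a -> I (r * a))].

Definition subI (I J : R -> Prop) : Prop := forall r, I r -> J r.
Definition strictI (I J : R -> Prop) : Prop := subI I J /\ exists r, J r /\ ~ I r.

Definition prime_ideal (P : R -> Prop) : Prop :=
  [/\ ideal P, ~ P 1 & (forall a b, P (a * b) -> P a \/ P b)].

Definition maximal_ideal (I : R -> Prop) : Prop :=
  [/\ ideal I, ~ I 1 & (forall J, ideal J -> ~ J 1 -> subI I J -> subI J I)].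

Definition local_ring (m : R -> Prop) : Prop :=
  maximal_ideal m /\ (forall I, maximal_ideal I -> forall r, I r <-> m r).

Definition noetherian : Prop :=
  forall I : nat -> R -> Prop, (forall n, ideal (I n)) ->
    (forall n, subI (I n) (I n.+1)) ->
    exists n0, forall n, (n0 <= n)%N -> forall r, I n r <-> I n0 r.

Definition gen_ideal (S : R -> Prop) : R -> Prop :=
  fun r => forall J, ideal J -> subI S J -> J r.

Definition ideal_cube (I : R -> Prop) : R -> Prop :=
  gen_ideal (fun x => exists a b c, [/\ I a, I b, I c & x = a * b * c]).

Definition prime_chain (A : R -> Prop) (n : nat) : Prop :=
  exists p : nat -> R -> Prop,
    [/\ forall i, (i <= n)%N -> prime_ideal (p i),
        subI A (p 0%N) &
        forall i, (i < n)%N -> strictI (p i) (p i.+1)].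

Definition chain_dim (A : R -> Prop) (d : nat) : Prop :=
  prime_chain A d /\ ~ prime_chain A d.+1.

Definition ring_dim (d : nat) : Prop := chain_dim (fun _ => False) d.

(* ---------- modules: M/K is represented by a submodule K of M ---------- *)
Variable M : lmodType R.

Definition submodule (N : M -> Prop) : Prop :=
  [/\ N 0, (forall u v, N u -> N v -> N (u + v)) & (forall r v, N v -> N (r *: v))].

Definition subM (N P : M -> Prop) : Prop := forall v, N v -> P v.
Definition strictM (N P : M -> Prop) : Prop := subM N P /\ exists v, P v /\ ~ N v.

Definition zero_sub : M -> Prop := fun v => v = 0.

Definition sub_gen (K : M -> Prop) (z : seq R) : M -> Prop :=
  fun v => forall N, submodule N -> subM K N ->
    (forall j w, (j < size z)%N -> N (z`_j *: w)) -> N v.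

Definition fin_gen : Prop :=
  exists s : seq M, forall v, exists c : 'I_(size s) -> R,
    v = \sum_(i < size s) c i *: s`_i.

Definition ann_quot (K : M -> Prop) : R -> Prop := fun r => forall v, K (r *: v).

Definition module_dim (K : M -> Prop) (d : nat) : Prop := chain_dim (ann_quot K) d.

Definition finite_length (K : M -> Prop) : Prop :=
  exists L : nat, forall (k : nat) (N : nat -> M -> Prop),
    (forall i, (i <= k)%N -> submodule (N i) /\ subM K (N i)) ->
    (forall i, (i < k)%N -> strictM (N i) (N i.+1)) -> (k <= L)%N.

Variable m : R -> Prop.

Definition sop (K : M -> Prop) (z : seq R) : Prop :=
  [/\ module_dim K (size z), (forall j, (j < size z)%N -> m z`_j)
    & finite_length (sub_gen K z)].

(* b(M/K) : intersection over all s.o.p. z of M/K and all i of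
   Ann( 0 :_{(M/K)/(z_1..z_{i-1})(M/K)} z_i )   (0-based index i here) *)
Definition bideal (K : M -> Prop) : R -> Prop :=
  fun r => forall z, sop K z -> forall i, (i < size z)%N ->
    forall v, sub_gen K (take i z) (z`_i *: v) -> sub_gen K (take i z) (r *: v).

(* C-system of parameters of M (0-based: x`_j in b(M/(x_{j+1},...,x_{d-1})M)^3) *)
Definition c_sop (x : seq R) : Prop :=
  sop zero_sub x /\
  forall j, (j < size x)%N -> ideal_cube (bideal (sub_gen zero_sub (drop j.+1 x))) x`_j.

(* dim_k Soc(M/Q) = n, where k = R/m; a k-basis is given by representatives *)
Definition socle (Q : M -> Prop) : M -> Prop :=
  fun v => forall r, m r -> Q (r *: v).

Definition socle_kdim (Q : M -> Prop) (n : nat) : Prop :=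
  exists v : 'I_n -> M,
    [/\ forall i, socle Q (v i),
        (forall w, socle Q w -> exists c : 'I_n -> R,
            Q (w - \sum_(i < n) c i *: v i)) &
        (forall c : 'I_n -> R, Q (\sum_(i < n) c i *: v i) -> forall i, m (c i))].

Definition ir_is (x : seq R) (n : nat) : Prop := socle_kdim (sub_gen zero_sub x) n.

End CommAlg.

(* Cohen-Macaulay local ring: Noetherian local with depth = dim, i.e. an
   S-regular sequence in mS of length dim S exists *)
Definition regular_seq (S : comNzRingType) (mS : S -> Prop) (z : seq S) : Prop :=
  (forall j, (j < size z)%N -> mS z`_j) /\
  ~ gen_ideal (fun r => exists j, (j < size z)%N /\ r = z`_j) 1 /\
  forall i, (i < size z)%N -> forall a,
    gen_ideal (fun r => exists j, (j < i)%N /\ r = z`_j) (z`_i * a) ->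
    gen_ideal (fun r => exists j, (j < i)%N /\ r = z`_j) a.

Definition cohen_macaulay_local (S : comNzRingType) (mS : S -> Prop) : Prop :=
  [/\ noetherian S, local_ring mS &
      exists d, ring_dim S d /\ exists z : seq S, size z = d /\ regular_seq mS z].

Definition cm_image (R : comNzRingType) : Prop :=
  exists (S : comNzRingType) (mS : S -> Prop) (f : {rmorphism S -> R}),
    cohen_macaulay_local mS /\ forall r : R, exists s, f s = r.

(* Main.v *)
(* Write [b_j] for the ideal [bideal] of [M / (x_(j+1), ..., x_(d-1)) M], which is
   [tail_bideal x j] below.

   If [K] is a submodule of [M], [B] an ideal, and [a] is an element of [m B] such that
   [B] annihilates the elements of [M / K] killed by [a ^+ 2], then
   [H := {v | B v <= K}] gives an exact sequence
     [0 -> (Soc (M / K) :&: H / K) -> Soc (M / (K + a M)) -> Soc (M / (H + a M)) -> 0],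
   and the dimension of the last term does not depend on [a] because [a] is a
   nonzerodivisor on [M / H].  Applied to [B := b_i], this shows that in a system of
   parameters [z_0, ..., z_(i-1), x_i, ..., x_(d-1)] the element [x_i] of [m b_i] can be
   exchanged for any other parameter in [m b_i], whatever [z_0, ..., z_(i-1)] are.

   Since [b_j] contains the annihilator of [M / (x_(j+1), ..., x_(d-1)) M] and [x_j],
   the ring [R / b_j] has dimension at most [j].  Prime avoidance therefore gives
   [z_0, ..., z_(d-1)], with [z_i] in [m b_i] for finitely many given C-systems of
   parameters, such that every [R / (b_j + (z_0, ..., z_(i-1)))] with [i <= j] has
   dimension at most [j - i] and all the exchanges are between systems of parameters.
   Exchanging from left to right transforms all the C-systems of parameters into [z]. *)
Require Import Defs.
From mathcomp Require Import all_boot all_algebra.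
From mathcomp Require Import boolp.
From mathcomp Require Import ring.
Set Implicit Arguments. Unset Strict Implicit. Unset Printing Implicit Defensive.
Import GRing.Theory.
Local Open Scope ring_scope.

Lemma mem_insert (T : eqType) (s t : seq T) a : s ++ a :: t =i rcons (s ++ t) a.
Proof. by move=> b; rewrite mem_rcons !(inE, mem_cat) orbCA. Qed.

Lemma subrACA (V : zmodType) (x y z t : V) : x - y - (z - t) = x - z - (y - t).
Proof. by rewrite !opprB addrACA [- y + _]addrC -addrACA. Qed.

Section Submodules.
Variables (R : comNzRingType) (M : lmodType R).
Implicit Types (N K L : M -> Prop) (I J : R -> Prop) (u v w : M) (a r : R).

Lemma scalerC a r v : a *: (r *: v) = r *: (a *: v).
Proof. by rewrite !scalerA mulrC. Qed.

Lemma submod0 N : submodule N -> N 0.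
Proof. by case. Qed.

Lemma submodD N u v : submodule N -> N u -> N v -> N (u + v).
Proof. by case=> _ + _; apply. Qed.

Lemma submodZ N r v : submodule N -> N v -> N (r *: v).
Proof. by case=> _ _; apply. Qed.

Lemma submodN N v : submodule N -> N v -> N (- v).
Proof. by move=> sN Nv; rewrite -scaleN1r; apply: submodZ. Qed.

Lemma submodB N u v : submodule N -> N u -> N v -> N (u - v).
Proof. by move=> sN Nu Nv; apply: submodD => //; apply: submodN. Qed.

Lemma submodBC N u v : submodule N -> N (u - v) -> N (v - u).
Proof. by move=> sN; rewrite -[v - u]opprB; apply: submodN. Qed.

Lemma submodDl N u v : submodule N -> N u -> N (u + v) <-> N v.
Proof.
move=> sN Nu; split=> [Nuv|]; last exact: submodD.
by rewrite -[v](addKr u) addrC; apply: submodB.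
Qed.

Lemma submodDr N u v : submodule N -> N v -> N (u + v) <-> N u.
Proof. by rewrite addrC; apply: submodDl. Qed.

Lemma submod_congr N u v : submodule N -> N (u - v) -> N u <-> N v.
Proof. by move=> sN Nuv; rewrite -[u](subrK v); apply: submodDl. Qed.

Lemma submod_sum N (J : finType) (F : J -> M) :
  submodule N -> (forall i, N (F i)) -> N (\sum_i F i).
Proof. by case=> N0 ND _ NF; apply: big_ind. Qed.

Lemma submod_lincomb N (J : finType) (c : J -> R) (F : J -> M) :
  submodule N -> (forall i, N (F i)) -> N (\sum_i c i *: F i).
Proof. by move=> sN NF; apply: submod_sum => // i; apply: submodZ. Qed.

Lemma subM_antisym N L : subM N L -> subM L N -> N = L.
Proof. by move=> NL LN; apply/predeqP => v; split; [apply: NL | apply: LN]. Qed.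

Lemma zero_submodule : submodule (@zero_sub R M).
Proof.
by rewrite /zero_sub; split=> [//|u v -> ->|r v ->]; rewrite ?addr0 ?scaler0.
Qed.

Definition cyclicM v : M -> Prop := fun w => exists t, w = t *: v.

Definition scaleM a : M -> Prop := fun w => exists v, w = a *: v.

Definition addM N L : M -> Prop := fun w => exists n l, [/\ N n, L l & w = n + l].

Definition mulM I N : M -> Prop := fun v =>
  forall L, submodule L -> (forall a w, I a -> N w -> L (a *: w)) -> L v.

Definition colonM N I : M -> Prop := fun v => forall a, I a -> N (a *: v).

Definition capM N L : M -> Prop := fun v => N v /\ L v.

Definition regular_mod N a : Prop := forall v, N (a *: v) -> N v.

Lemma cyclicM_submodule v : submodule (cyclicM v).
Proof.
split=> [|_ _ [s ->] [t ->]|r _ [t ->]].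
- by exists 0; rewrite scale0r.
- by exists (s + t); rewrite scalerDl.
- by exists (r * t); rewrite scalerA.
Qed.

Lemma scaleM_submodule a : submodule (scaleM a).
Proof.
split=> [|_ _ [u ->] [v ->]|r _ [v ->]].
- by exists 0; rewrite scaler0.
- by exists (u + v); rewrite scalerDr.
- by exists (r *: v); rewrite scalerC.
Qed.

Lemma scaleM_exp a n : subM (scaleM (a ^+ n.+1)) (scaleM (a ^+ n)).
Proof. by move=> _ [v ->]; exists (a *: v); rewrite scalerA -exprSr. Qed.

Lemma addM_submodule N L : submodule N -> submodule L -> submodule (addM N L).
Proof.
move=> sN sL.
split=> [|_ _ [n [l [Nn Ll ->]]] [n' [l' [Nn' Ll' ->]]]|r _ [n [l [Nn Ll ->]]]].
- by exists 0, 0; rewrite addr0; split=> //; apply: submod0.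
- by exists (n + n'), (l + l'); rewrite addrACA; split=> //; apply: submodD.
- by exists (r *: n), (r *: l); rewrite scalerDr; split=> //; apply: submodZ.
Qed.

Lemma addM_subl N L : submodule L -> subM N (addM N L).
Proof. by move=> sL n Nn; exists n, 0; rewrite addr0; split=> //; apply: submod0. Qed.

Lemma addM_subr N L : submodule N -> subM L (addM N L).
Proof. by move=> sN l Ll; exists 0, l; rewrite add0r; split=> //; apply: submod0. Qed.

Lemma addM_min N L K : submodule K -> subM N K -> subM L K -> subM (addM N L) K.
Proof. by move=> sK NK LK _ [n [l [/NK Kn /LK Kl ->]]]; apply: submodD. Qed.

Lemma addM_mono N N' L L' : subM N N' -> subM L L' -> subM (addM N L) (addM N' L').
Proof. by move=> NN' LL' _ [n [l [/NN' Nn /LL' Ll ->]]]; exists n, l. Qed.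

Definition adjoinM N v : M -> Prop := addM N (cyclicM v).

Lemma adjoinM_submodule N v : submodule N -> submodule (adjoinM N v).
Proof. by move=> sN; apply: addM_submodule => //; apply: cyclicM_submodule. Qed.

Lemma adjoinM_sub N v : subM N (adjoinM N v).
Proof. exact/addM_subl/cyclicM_submodule. Qed.

Lemma adjoinM_id N v : submodule N -> adjoinM N v v.
Proof. by move=> sN; apply: addM_subr => //; exists 1; rewrite scale1r. Qed.

Lemma adjoinM_min N L v : submodule L -> subM N L -> L v -> subM (adjoinM N v) L.
Proof. by move=> sL NL Lv; apply: addM_min => // _ [t ->]; apply: submodZ. Qed.

Lemma adjoinM_mono N L v : subM N L -> subM (adjoinM N v) (adjoinM L v).
Proof. by move=> NL; apply: addM_mono. Qed.

Lemma adjoinM_strict N v : submodule N -> ~ N v -> strictM N (adjoinM N v).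
Proof.
by move=> sN Nv; split; [apply: adjoinM_sub | exists v; split=> //; apply: adjoinM_id].
Qed.

Lemma addM_scaleP N a w : addM N (scaleM a) w <-> exists v, N (w - a *: v).
Proof.
split=> [[n [_ [Nn [v ->] ->]]]|[v Nwv]]; first by exists v; rewrite addrK.
by exists (w - a *: v), (a *: v); rewrite subrK; split=> //; exists v.
Qed.

Lemma mulM_submodule I N : submodule (mulM I N).
Proof.
split=> [L sL _|u v Iu Iv L sL IL|r v Iv L sL IL]; first exact: submod0.
  by apply: submodD => //; [apply: Iu | apply: Iv].
by apply: submodZ => //; apply: Iv.
Qed.

Lemma mulM_mem I N a v : I a -> N v -> mulM I N (a *: v).
Proof. by move=> Ia Nv L _; apply. Qed.

Lemma capM_submodule N L : submodule N -> submodule L -> submodule (capM N L).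
Proof.
move=> [N0 ND NZ] [L0 LD LZ].
by split=> [|u v [Nu Lu] [Nv Lv]|r v [Nv Lv]]; split; auto.
Qed.

Lemma colonM_submodule N I : submodule N -> submodule (colonM N I).
Proof.
move=> sN; split=> [a _|u v Nu Nv a Ia|r v Nv a Ia].
- by rewrite scaler0; apply: submod0.
- by rewrite scalerDr; apply: submodD => //; [apply: Nu | apply: Nv].
- by rewrite scalerC; apply: submodZ => //; apply: Nv.
Qed.

Lemma colonM_sub N I : submodule N -> subM N (colonM N I).
Proof. by move=> sN v Nv a _; apply: submodZ. Qed.

Lemma colon_ideal N v : submodule N -> ideal (fun r => N (r *: v)).
Proof.
move=> sN; split=> [|a b Na Nb|r a Na]; first by rewrite scale0r; apply: submod0.
  by rewrite scalerDl; apply: submodD.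
by rewrite -scalerA; apply: submodZ.
Qed.

Definition acc_submodules : Prop := forall N : nat -> M -> Prop,
  (forall n, submodule (N n)) -> (forall n, subM (N n) (N n.+1)) ->
  exists n0, forall n, (n0 <= n)%N -> subM (N n) (N n0).

Lemma submodule_noetherian_ind (P : (M -> Prop) -> Prop) : acc_submodules ->
  (forall N, submodule N -> (forall N', submodule N' -> strictM N N' -> P N') -> P N) ->
  forall N, submodule N -> P N.
Proof.
move=> acc step N0 sN0; apply: contrapT => nP0.
pose bad := {N | submodule N /\ ~ P N}.
have [next lt_next] : {f : bad -> bad & forall B : bad, strictM (sval B) (sval (f B))}.
  apply: (@choice _ _ (fun B C : bad => strictM (sval B) (sval C))) => -[N [sN nPN]] /=.
  apply: contrapT => no_next.
  apply/nPN/step => // N' sN' ltNN'; apply: contrapT => nPN'.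
  by apply: no_next; exists (exist _ N' (conj sN' nPN')).
pose N n := sval (iter n next (exist _ N0 (conj sN0 nP0))).
have ltN n : strictM (N n) (N n.+1) by exact: lt_next.
have sN n : submodule (N n) by rewrite /N; case: (iter n next _) => N' [].
have [n|n0 /(_ n0.+1 (leqnSn _)) stop] := acc N sN; first by case: (ltN n).
by case: (ltN n0) => _ [v [/stop]].
Qed.

End Submodules.

Arguments zero_submodule {R M}.
Arguments submod0 {R M N} _.
Arguments submodZ {R M N} r {v} _ _.

Section NoetherianModules.
Variable R : comNzRingType.
Hypothesis noeR : noetherian R.

Lemma noetherian_acc : acc_submodules R^o.
Proof.
move=> I iI I_incr; have [n0 stable] := noeR iI I_incr.
by exists n0 => n /stable eq_I v; case: (eq_I v).
Qed.

Variable M : lmodType R.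
Implicit Types (S : M -> Prop) (s : seq M).

Section StableChain.
Variable N : nat -> M -> Prop.
Hypotheses (sN : forall n, submodule (N n)) (N_incr : forall n, subM (N n) (N n.+1)).

Definition stable_on S : Prop :=
  exists n0, forall n, (n0 <= n)%N -> forall v, S v -> N n v -> N n0 v.

Lemma stable_on_adjoin S g : submodule S -> stable_on S -> stable_on (adjoinM S g).
Proof.
move=> sS [n0 stable_S].
have N_homo : {homo N : i j / (i <= j)%N >-> subM i j}.
  by apply: homo_leq => // [L v|L K L' KL LL' v /KL /LL'].
pose I n t := exists2 w, S w & N n (w + t *: g).
have [n|n t [w Sw Nw]|n1 stable_I] := noeR (I := I).
- split=> [|a b [u Su Nu] [w Sw Nw]|r a [w Sw Nw]].
  + by exists 0; rewrite ?scale0r ?addr0; apply: submod0.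
  + by exists (u + w); rewrite ?scalerDl 1?addrACA; apply: submodD.
  + by exists (r *: w); rewrite -?scalerA -?scalerDr; apply: submodZ.
- by exists w => //; apply: N_incr.
exists (maxn n0 n1) => n; rewrite geq_max => /andP[le0 le1] _ [w [_ [Sw [t ->] ->]]] Nv.
have [w' Sw' Nw'] : I n1 t by apply/(stable_I n le1); exists w.
have Nww' : N n0 (w - w').
  apply: (stable_S n) => //; first exact: submodB.
  have -> : w - w' = w + t *: g - (w' + t *: g) by rewrite opprD addrACA subrr addr0.
  by apply: submodB => //; apply: N_homo Nw'.
have -> : w + t *: g = w - w' + (w' + t *: g) by rewrite addrA subrK.
by apply: submodD => //; [apply: N_homo Nww'; apply: leq_maxl |
  apply: N_homo Nw'; apply: leq_maxr].
Qed.

End StableChain.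

Definition spanM s : M -> Prop := foldr (fun g S => adjoinM S g) (@zero_sub R M) s.

Lemma spanM_submodule s : submodule (spanM s).
Proof.
elim: s => [|g s IHs] /=; first exact: zero_submodule.
exact: adjoinM_submodule.
Qed.

Lemma spanM_mem s v : v \in s -> spanM s v.
Proof.
elim: s => //= g s IHs; rewrite inE => /predU1P[->|/IHs].
  by apply/adjoinM_id/spanM_submodule.
exact: adjoinM_sub.
Qed.

Lemma fin_gen_spanM : fin_gen M -> exists s, forall v, spanM s v.
Proof.
move=> [s gen]; exists s => v; have [c ->] := gen v.
by apply: submod_lincomb => [|i]; [apply: spanM_submodule | apply/spanM_mem/mem_nth].
Qed.

Lemma fin_gen_acc : fin_gen M -> acc_submodules M.
Proof.
move=> /fin_gen_spanM[s full] N sN N_incr.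
suff [n0 stable] : stable_on N (spanM s) by exists n0 => n le_n v; apply: stable.
elim: s {full} => [|g s IHs] /=; first by exists 0%N => n _ _ -> _; apply: submod0.
by apply: stable_on_adjoin => //; apply: spanM_submodule.
Qed.

End NoetherianModules.

Section Ideals.
Variable R : comNzRingType.
Implicit Types (A I J P Q : R -> Prop) (a b r : R).

Lemma ideal_mull I r a : ideal I -> I a -> I (r * a).
Proof. exact: (@submodZ R R^o). Qed.

Lemma ideal_mulr I r a : ideal I -> I a -> I (a * r).
Proof. by rewrite mulrC; apply: ideal_mull. Qed.

Lemma ideal_addl I a b : ideal I -> I a -> I (a + b) <-> I b.
Proof. exact: (@submodDl R R^o). Qed.

Lemma ideal_addr I a b : ideal I -> I b -> I (a + b) <-> I a.
Proof. exact: (@submodDr R R^o). Qed.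

Lemma ideal_adjoin I a : ideal I -> ideal (adjoinM (I : R^o -> Prop) a).
Proof. exact: (@adjoinM_submodule R R^o). Qed.

Lemma gen_ideal_ideal A : ideal (gen_ideal A).
Proof.
split=> [J iJ _|a b Aa Ab J iJ AJ|r a Aa J iJ AJ]; first by case: iJ.
  by have [_ JD _] := iJ; apply: JD; [apply: Aa | apply: Ab].
by apply: ideal_mull => //; apply: Aa.
Qed.

Lemma gen_ideal_subP A J : ideal J -> subI (gen_ideal A) J <-> subI A J.
Proof. by move=> iJ; split=> [AJ a Aa|AJ a]; [apply: AJ => K _; apply | apply]. Qed.

Definition ideal_prod I J : R -> Prop :=
  gen_ideal (fun x => exists a b, [/\ I a, J b & x = a * b]).

Lemma ideal_prod_ideal I J : ideal (ideal_prod I J).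
Proof. exact: gen_ideal_ideal. Qed.

Lemma ideal_prod_mul I J a b : I a -> J b -> ideal_prod I J (a * b).
Proof. by move=> Ia Jb K _; apply; exists a, b. Qed.

Lemma ideal_prod_subl I J : ideal I -> subI (ideal_prod I J) I.
Proof. by move=> iI; apply/gen_ideal_subP => // _ [a [b [Ia _ ->]]]; apply: ideal_mulr. Qed.

Lemma ideal_prod_subr I J : ideal J -> subI (ideal_prod I J) J.
Proof. by move=> iJ; apply/gen_ideal_subP => // _ [a [b [_ Jb ->]]]; apply: ideal_mull. Qed.

Lemma ideal_cube_sub I : ideal I -> subI (ideal_cube I) I.
Proof.
by move=> iI; apply/gen_ideal_subP => // _ [a [b [c [_ _ Ic ->]]]]; apply: ideal_mull.
Qed.

Definition adjoinI A (z : seq R) : R -> Prop := fun a => A a \/ a \in z.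

Lemma adjoinI_subP A z J : subI (adjoinI A z) J <-> subI A J /\ (forall a, a \in z -> J a).
Proof.
split=> [AzJ|[AJ zJ] a [/AJ|/zJ]//].
by split=> a ?; apply: AzJ; [left | right].
Qed.

Lemma adjoinI_cat A s t : adjoinI (adjoinI A s) t = adjoinI A (s ++ t).
Proof.
apply/predeqP => a; split=> [[[Aa|sa]|ta]|[Aa|]].
- by left.
- by right; rewrite mem_cat sa.
- by right; rewrite mem_cat ta orbT.
- by left; left.
- by rewrite mem_cat => /orP[sa|ta]; [left; right | right].
Qed.

Lemma eq_mem_adjoinI A s t : s =i t -> adjoinI A s = adjoinI A t.
Proof. by move=> st; apply/predeqP => a; rewrite /adjoinI st. Qed.

Lemma prime_mul_notin P a b : prime_ideal P -> ~ P a -> ~ P b -> ~ P (a * b).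
Proof. by move=> [_ _ prP] Pa Pb /prP[]. Qed.

Lemma ideal_prod_not_sub_prime I J P : prime_ideal P -> ~ subI I P -> ~ subI J P ->
  ~ subI (ideal_prod I J) P.
Proof.
move=> prP /existsPNP[a Ia Pa] /existsPNP[b Jb Pb] /(_ (a * b)) Pab.
exact: prime_mul_notin Pa Pb (Pab (ideal_prod_mul Ia Jb)).
Qed.

Lemma prime_exp P a n : prime_ideal P -> P (a ^+ n) -> P a.
Proof.
move=> [_ P1 prP]; elim: n => [|n IHn]; first by rewrite expr0 => /P1.
by rewrite exprS => /prP[].
Qed.

Lemma not_prime_ideal I : ideal I -> ~ I 1 -> ~ prime_ideal I ->
  exists a b, [/\ I (a * b), ~ I a & ~ I b].
Proof.
move=> iI I1 nprI; apply: contrapT => no_ab; apply: nprI; split=> // a b Iab.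
apply: contrapT => /not_orP[Ia Ib]; apply: no_ab.
by exists a, b.
Qed.

Lemma minimal_primes I : noetherian R -> ideal I -> exists Ps : seq (R -> Prop),
  (forall P, P \in Ps -> prime_ideal P /\ subI I P) /\
  (forall P, prime_ideal P -> subI I P -> exists2 Q, Q \in Ps & subI Q P).
Proof.
move=> noeR; move: I.
apply: (submodule_noetherian_ind (M := R^o) (noetherian_acc noeR)) => I iI IHI.
have [I1|I1] := pselect (I 1).
  by exists [::]; split=> // P [_ P1 _] IP; case: P1; apply: IP.
have [prI|nprI] := pselect (prime_ideal I).
  exists [:: I]; split=> [P|P prP IP]; first by rewrite inE => /eqP->; split.
  by exists I; rewrite ?mem_head.
have [a [b [Iab Ia Ib]]] := not_prime_ideal iI I1 nprI.
have [Ps [PsP Ps_min]] := IHI _ (ideal_adjoin a iI) (adjoinM_strict iI Ia).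
have [Qs [QsP Qs_min]] := IHI _ (ideal_adjoin b iI) (adjoinM_strict iI Ib).
exists (Ps ++ Qs); split=> [P|P prP IP].
  by rewrite mem_cat => /orP[/PsP|/QsP] [prP IP]; split=> // c Ic; apply/IP/adjoinM_sub.
have [iP _ /(_ a b (IP _ Iab))] := prP.
have adjoin_sub c : P c -> subI (adjoinM (I : R^o -> Prop) c) P by apply: adjoinM_min.
case=> /adjoin_sub; [case/(Ps_min _ prP) | case/(Qs_min _ prP)] => Q QPs QP;
  by exists Q; rewrite // mem_cat QPs ?orbT.
Qed.

Definition bigcapI (Is : seq (R -> Prop)) : R -> Prop := fun a => forall I, I \in Is -> I a.

Lemma bigcapI_ideal (Is : seq (R -> Prop)) :
  (forall I, I \in Is -> ideal I) -> ideal (bigcapI Is).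
Proof.
move=> IsP; split=> [I /IsP[]//|a b Ia Ib I inI|r a Ia I inI].
  by have [_ ID _] := IsP I inI; apply: ID; [apply: Ia | apply: Ib].
by apply: ideal_mull; [apply: IsP | apply: Ia].
Qed.

Lemma bigcapI_not_sub_prime P (Is : seq (R -> Prop)) : prime_ideal P ->
  (forall I, I \in Is -> ideal I /\ ~ subI I P) -> ~ subI (bigcapI Is) P.
Proof.
move=> prP IsP; apply/existsPNP; elim: Is IsP => [|I Is IHs] IsP.
  by exists 1 => [J|]; last by case: prP.
have [J Js|a Ia Pa] := IHs; first by apply: IsP; rewrite inE Js orbT.
have [iI /existsPNP[b Ib Pb]] := IsP I (mem_head I Is).
exists (a * b); last exact: prime_mul_notin.
move=> J; rewrite inE => /predU1P[->|Js]; first exact: ideal_mull.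
by apply: ideal_mulr; [apply: (IsP J _).1; rewrite inE Js orbT | apply: Ia].
Qed.

Lemma prime_avoidance J (Ps : seq (R -> Prop)) : ideal J ->
  (forall P, P \in Ps -> prime_ideal P /\ ~ subI J P) ->
  exists2 a, J a & forall P, P \in Ps -> ~ P a.
Proof.
move=> iJ; elim: Ps => [|P Ps IHs] PsP; first by exists 0; case: iJ.
have [Q Qs|a Ja avoid_a] := IHs; first by apply: PsP; rewrite inE Qs orbT.
have [prP nJP] := PsP P (mem_head P Ps).
have [Pa|Pa] := pselect (P a); last first.
  by exists a => // Q; rewrite inE => /predU1P[->|/avoid_a].
pose Is := J :: [seq Q <- Ps | ~~ `[< subI Q P >]].
have /existsPNP[b inb Pb] : ~ subI (bigcapI Is) P.
  apply: bigcapI_not_sub_prime => // I.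
  rewrite inE mem_filter => /predU1P[->//|/andP[/asboolPn nQP Qs]].
  by split=> //; case: (PsP I); rewrite ?inE ?Qs ?orbT // => -[].
have Jb : J b by apply: inb; apply: mem_head.
have Pab : ~ P (a + b) by case: prP => iP _ _; rewrite (ideal_addl _ iP Pa).
exists (a + b) => [|Q]; first by have [_ JD _] := iJ; apply: JD.
rewrite inE => /predU1P[->//|Qs].
have [QP|nQP] := pselect (subI Q P); first by move/QP.
have [[iQ _ _] _] : prime_ideal Q /\ ~ subI J Q by apply: PsP; rewrite inE Qs orbT.
rewrite (ideal_addr _ iQ); first exact: avoid_a.
by apply: inb; rewrite inE mem_filter Qs andbT; apply/orP; right; apply/asboolPn.
Qed.

End Ideals.

Section Localization.
Variables (R : comNzRingType) (M : lmodType R).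
Implicit Types (N K L : M -> Prop) (P Q : R -> Prop).

(* The submodules saturated at [P] are the contractions of the submodules of the
   localization of [M] at [P]. *)
Definition saturated P N : Prop := forall s v, ~ P s -> N (s *: v) -> N v.

Definition saturation P N : M -> Prop := fun v => exists2 s, ~ P s & N (s *: v).

Lemma saturation_submodule P N : prime_ideal P -> submodule N -> submodule (saturation P N).
Proof.
move=> prP sN; have [_ P1 _] := prP.
split=> [|u v [s Ps Nu] [t Pt Nv]|a v [s Ps Nv]].
- by exists 1; rewrite ?scaler0; [ | apply: submod0].
- exists (s * t); first exact: prime_mul_notin.
  rewrite scalerDr; apply: submodD => //; last by rewrite -scalerA; apply: submodZ.
  by rewrite mulrC -scalerA; apply: submodZ.
- by exists s; rewrite // scalerC; apply: submodZ.
Qed.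

Lemma saturation_sub P N : prime_ideal P -> subM N (saturation P N).
Proof. by move=> [_ P1 _] v Nv; exists 1; rewrite ?scale1r. Qed.

Lemma saturation_saturated P N : prime_ideal P -> saturated P (saturation P N).
Proof.
move=> prP s v Ps [t Pt Nv].
by exists (t * s); [apply: prime_mul_notin | rewrite -scalerA].
Qed.

Lemma saturated_mono P Q N : subI P Q -> saturated P N -> saturated Q N.
Proof. by move=> PQ satN s v Qs; apply: satN => /PQ. Qed.

Lemma saturation_min P N L : saturated P L -> subM N L -> subM (saturation P N) L.
Proof. by move=> satL NL v [s Ps /NL]; apply: satL. Qed.

Lemma saturation_mono P N L : subM N L -> subM (saturation P N) (saturation P L).
Proof. by move=> NL v [s Ps /NL]; exists s. Qed.

Lemma saturation_adjoinM_strict P N v : prime_ideal P -> submodule N -> ~ N v ->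
  strictM N (saturation P (adjoinM N v)).
Proof.
move=> prP sN Nv; have [sub_adj [w [adj_w Nw]]] := adjoinM_strict sN Nv.
split=> [u /sub_adj|]; first exact: saturation_sub.
by exists w; split=> //; apply: saturation_sub.
Qed.

Lemma saturated_adjoin_coef P N n t v : prime_ideal P -> submodule N -> saturated P N ->
  N n -> ~ N v -> N (n + t *: v) -> P t.
Proof.
move=> prP sN satN Nn Nv; rewrite submodDl // => Ntv.
by apply: contrapT => Pt; apply: Nv; apply: satN Ntv.
Qed.

Lemma nakayama P K N : acc_submodules M -> prime_ideal P -> submodule K ->
  subM N (saturation P (addM K (mulM P N))) -> subM N (saturation P K).
Proof.
move=> acc prP sK N_gen; have [iP _ _] := prP.
suff sub_sat L : submodule L -> saturated P L /\ subM K L -> subM N L.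
  apply: sub_sat; first exact: saturation_submodule.
  by split; [apply: saturation_saturated | apply: saturation_sub].
move: L; apply: submodule_noetherian_ind => // L sL IHL [satL KL].
have [PN_L|/existsNP[a /existsNP[v]]] := pselect (forall a v, P a -> N v -> L (a *: v)).
  move=> v /N_gen; apply: saturation_min => //.
  by apply: addM_min => // w; apply.
move=> /not_implyP[Pa /not_implyP[Nv nLav]]; case: (nLav); apply: submodZ => //.
have [LLav ltLLav] := saturation_adjoinM_strict prP sL nLav.
have [|||s Ps [n [_ [Ln [t ->] sv]]]] :=
    IHL (saturation P (adjoinM L (a *: v))) _ _ _ v Nv.
- exact/saturation_submodule/adjoinM_submodule.
- by [].
- by split; [apply: saturation_saturated | move=> u /KL /LLav].
apply: (satL (s - t * a)); last by rewrite scalerBl sv scalerA addrK.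
move=> Psta; apply: Ps.
by rewrite -(subrK (t * a) s) ideal_addl //; apply: ideal_mull.
Qed.

Lemma nakayama_regular P N N' a :
  acc_submodules M -> prime_ideal P -> submodule N -> submodule N' -> subM N' N ->
  P a -> regular_mod N a ->
  subM N (saturation P (addM N' (scaleM a))) -> subM N (saturation P N').
Proof.
move=> acc prP sN sN' N'N Pa reg_a N_gen; apply: nakayama => // v Nv.
have [s Ps [n [_ [N'n [w ->] sv]]]] := N_gen v Nv.
exists s => //; exists n, (a *: w); split=> //; apply: mulM_mem => //.
by apply: reg_a; rewrite -(submodDl (a *: w) sN (N'N n N'n)) -sv; apply: submodZ.
Qed.

Lemma associated_prime K v0 : noetherian R -> submodule K -> ~ K v0 ->
  exists2 v, ~ K v & prime_ideal (fun a => K (a *: v)).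
Proof.
move=> noeR sK.
suff associated I : ideal I -> forall v, I = (fun a => K (a *: v)) -> ~ K v ->
    exists2 w, ~ K w & prime_ideal (fun a => K (a *: w)).
  exact: associated (colon_ideal v0 sK) v0 erefl.
move: I; apply: (submodule_noetherian_ind (M := R^o) (noetherian_acc noeR)).
move=> I iI IHI v def_I Kv; subst I.
have [prI|nprI] := pselect (prime_ideal (fun a => K (a *: v))); first by exists v.
have [|a [b [Kab Ka Kb]]] := not_prime_ideal iI _ nprI; first by rewrite scale1r.
apply: (IHI (fun c => K (c *: (b *: v)))) Kb => //; first exact: colon_ideal.
split=> [c Kcv|]; first by rewrite scalerC; apply: submodZ.
by exists a; rewrite scalerA.
Qed.

(* [local_length P n K] says that the localization of [M / K] at [P] has a
   composition series of length [n]. *)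
Inductive local_length P : nat -> (M -> Prop) -> Prop :=
| LocalLength0 K : (forall v, K v) -> local_length P 0 K
| LocalLengthS n K v : ~ K v -> (forall a, P a -> K (a *: v)) ->
    local_length P n (saturation P (adjoinM K v)) -> local_length P n.+1 K.

Lemma local_length_strict P n K N : prime_ideal P -> local_length P n K ->
  submodule K -> saturated P K -> submodule N -> saturated P N -> subM K N ->
  exists n', [/\ local_length P n' N, (n' <= n)%N & strictM K N -> (n' < n)%N].
Proof.
move=> prP lenK; elim: lenK N => {n K} [K full|n K v Kv PvK lenK IHn] N sK satK sN satN KN.
  exists 0%N; split=> // [|[_ [v [_ []]]]//].
  by apply: LocalLength0 => v; apply: KN.
have sKv := saturation_submodule prP (adjoinM_submodule v sK).
have satKv := saturation_saturated (N := adjoinM K v) prP.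
have [Nv|Nv] := pselect (N v).
  have [|n' [lenN le_n' _]] := IHn N sKv satKv sN satN.
    by apply: saturation_min => //; apply: adjoinM_min.
  by exists n'; split; rewrite ?ltnS // leqW.
pose Nv' := saturation P (adjoinM N v).
have sNv := adjoinM_submodule v sN.
have [|||n' [lenN le_n' lt_n']] := IHn Nv' sKv satKv.
- exact: saturation_submodule.
- exact: saturation_saturated.
- exact/saturation_mono/adjoinM_mono.
exists n'.+1; split=> // [|[_ [w [Nw Kw]]]].
  by apply: LocalLengthS lenN => // a /PvK /KN.
rewrite ltnS; apply: lt_n'; split; first exact/saturation_mono/adjoinM_mono.
exists w; split; first exact/saturation_sub/adjoinM_sub.
move=> [s Ps [k [_ [Kk [t ->] sw]]]]; apply: Kw; apply: (satK s) => //.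
rewrite sw; apply: submodD => //; apply: PvK.
apply: (saturated_adjoin_coef (n := k) prP sN satN _ Nv); first exact: KN.
by rewrite -sw; apply: submodZ.
Qed.

Definition chains_bounded (C : (M -> Prop) -> Prop) b : Prop :=
  forall k (N : nat -> M -> Prop), (forall i, (i <= k)%N -> C (N i)) ->
    (forall i, (i < k)%N -> strictM (N i) (N i.+1)) -> (k <= b)%N.

Lemma chains_bounded_dcc C b (D : nat -> M -> Prop) : chains_bounded C b ->
  (forall n, C (D n)) -> (forall n, subM (D n.+1) (D n)) -> exists n, subM (D n) (D n.+1).
Proof.
move=> bounded CD D_decr; apply: contrapT => /forallNP never_stable.
suff : (b.+1 <= b)%N by rewrite ltnn.
apply: (bounded b.+1 (fun i => D (b.+1 - i)%N)) => // i; rewrite ltnS => le_ib.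
rewrite subSS subSn //; split; first exact: D_decr.
by have /existsPNP[v] := never_stable (b - i)%N; exists v.
Qed.

Lemma local_length_chains_bounded P b K : prime_ideal P -> local_length P b K ->
  submodule K -> saturated P K ->
  chains_bounded (fun N => [/\ submodule N, saturated P N & subM K N]) b.
Proof.
move=> prP lenK sK satK k N CN ltN.
suff /(_ k (leqnn k))[n le_nb _] : forall i, (i <= k)%N ->
    exists2 n, (n + i <= b)%N & local_length P n (N i).
  by apply: leq_trans le_nb; apply: leq_addl.
elim=> [_|i IHi lt_ik].
  have [sN0 satN0 KN0] := CN 0%N isT.
  have [n [lenN le_n _]] := local_length_strict prP lenK sK satK sN0 satN0 KN0.
  by exists n; rewrite ?addn0.
have [n le_nb lenN] := IHi (ltnW lt_ik).
have [[sN satN _] [sN' satN' _]] := (CN i (ltnW lt_ik), CN i.+1 lt_ik).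
have [NN' _] := ltN i lt_ik.
have [n' [lenN' _ /(_ (ltN i lt_ik)) lt_n']] :=
  local_length_strict prP lenN sN satN sN' satN' NN'.
by exists n' => //; rewrite addnS -addSn; apply: leq_trans le_nb; rewrite leq_add2r.
Qed.

Definition minimal_over (I : R -> Prop) P : Prop :=
  forall Q, prime_ideal Q -> subI I Q -> subI Q P -> subI P Q.

Lemma local_length_exists P K : acc_submodules M -> noetherian R -> prime_ideal P ->
  submodule K -> saturated P K -> minimal_over (ann_quot K) P ->
  exists b, local_length P b K.
Proof.
move=> acc noeR prP sK.
move: K sK; apply: submodule_noetherian_ind => // K sK IHK satK minP.
have [full|/existsNP[v0 Kv0]] := pselect (forall v, K v).
  by exists 0%N; apply: LocalLength0.
have [v Kv prv] := associated_prime noeR sK Kv0.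
have PvK : forall a, P a -> K (a *: v).
  apply: (minP _ prv) => a Kav; first exact: Kav.
  by apply: contrapT => Pa; apply: Kv; apply: satK Kav.
have ltK := saturation_adjoinM_strict prP sK Kv; have [KKv _] := ltK.
have [|//||Q prQ annQ|b lenb] := IHK (saturation P (adjoinM K v)).
- exact/saturation_submodule/adjoinM_submodule.
- exact: saturation_saturated.
- by apply: minP => // a Ka; apply: annQ => u; apply: KKv.
by exists b.+1; apply: LocalLengthS lenb.
Qed.

Lemma descending_chain_stable_at P K (D : nat -> M -> Prop) :
  acc_submodules M -> noetherian R -> prime_ideal P -> submodule K ->
  minimal_over (ann_quot K) P -> (forall n, submodule (D n)) -> (forall n, subM K (D n)) ->
  (forall n, subM (D n.+1) (D n)) -> exists n, subM (D n) (saturation P (D n.+1)).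
Proof.
move=> acc noeR prP sK minP sD KD D_decr.
have sSK := saturation_submodule prP sK.
have satK := saturation_saturated (N := K) prP.
have [Q prQ annQ QP|b lenb] := local_length_exists acc noeR prP sSK satK.
  by apply: minP => // a Ka; apply: annQ => v; apply: saturation_sub.
have [n|n|n D_stable] := chains_bounded_dcc (D := fun n => saturation P (D n))
    (local_length_chains_bounded prP lenb sSK satK).
- split; [exact: saturation_submodule | exact: saturation_saturated |].
  exact: saturation_mono.
- exact: saturation_mono.
by exists n => v Dv; apply/D_stable/saturation_sub.
Qed.

End Localization.

Section Krull.
Variable R : comNzRingType.
Hypothesis noeR : noetherian R.
Implicit Types (A I P Q : R -> Prop) (a u y : R) (z : seq R).

Section SymbolicPowers.
Variables (P Q : R -> Prop) (y : R).
Hypotheses (prP : prime_ideal P) (prQ : prime_ideal Q) (PQ : subI P Q).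

(* The [Q]-primary component of [P + (y ^+ n)]. *)
Definition symbolic_power n : R -> Prop :=
  saturation Q (addM (P : R^o -> Prop) (scaleM (y ^+ n))).

Let sum_submodule n : submodule (addM (P : R^o -> Prop) (scaleM (y ^+ n))).
Proof. by apply: addM_submodule; [case: prP | apply: scaleM_submodule]. Qed.

Lemma symbolic_power_ideal n : ideal (symbolic_power n).
Proof. exact: saturation_submodule (sum_submodule n). Qed.

Lemma symbolic_power_decr n : subI (symbolic_power n.+1) (symbolic_power n).
Proof.
by apply: (saturation_mono (M := R^o)); apply: addM_mono => //; apply: scaleM_exp.
Qed.

Lemma symbolic_power_base n : subI P (symbolic_power n).
Proof.
by move=> a Pa; apply/saturation_sub/addM_subl => //; apply: scaleM_submodule.
Qed.

Lemma symbolic_power_exp n : symbolic_power n (y ^+ n).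
Proof.
apply: saturation_sub => //; apply: addM_subr; first by case: prP.
by exists 1; rewrite /GRing.scale /= mulr1.
Qed.

Lemma symbolic_power_exp_notin n : Q y -> ~ P y -> ~ symbolic_power n.+1 (y ^+ n).
Proof.
have [[iP _ prodP] [iQ _ _]] := (prP, prQ).
move=> Qy Py [s Qs [a [_ [Pa [t ->] eq_syn]]]].
have : P (y ^+ n * (s - y * t)).
  suff -> : y ^+ n * (s - y * t) = a by [].
  have {}eq_syn : s * y ^+ n = a + y ^+ n.+1 * t := eq_syn.
  by rewrite mulrBr mulrC eq_syn exprSr mulrA addrK.
case/prodP=> [/(prime_exp prP) //|/PQ Qst]; apply: Qs.
by rewrite -(subrK (y * t) s) ideal_addl //; apply: ideal_mulr.
Qed.

End SymbolicPowers.

(* If [P] is strictly contained in [Q], then the symbolic powers of an element of [Q] outside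
   [P] are stationary at [T], by the finite length of [R / (P + (u))] at [T] and Nakayama's
   lemma. *)
Lemma krull_principal_ideal P Q T u : prime_ideal P -> prime_ideal Q -> prime_ideal T ->
  subI Q T -> T u -> ~ Q u -> minimal_over (adjoinI P [:: u]) T -> ~ strictI P Q.
Proof.
move=> prP prQ prT QT Tu Qu minT [PQ [y [Qy Py]]].
have iP : submodule (P : R^o -> Prop) by case: prP.
have su := scaleM_submodule R^o u.
pose S n : R^o -> Prop := symbolic_power P Q y n.
have sS n : submodule (S n) := symbolic_power_ideal y prP prQ n.
pose K : R^o -> Prop := addM (P : R^o -> Prop) (scaleM u).
have sK : submodule K by apply: addM_submodule.
have minK : minimal_over (ann_quot K) T.
  move=> I prI annI; apply: minT => //; apply/adjoinI_subP; split=> [a Pa|a].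
    by apply: annI => v; apply: addM_subl => //; apply: (ideal_mulr (I := P)).
  by rewrite inE => /eqP->; apply: annI => v; apply: addM_subr => //; exists v.
have [n|n|n|n S_stable] := descending_chain_stable_at (D := fun n => addM (S n) (scaleM u))
    (noetherian_acc noeR) noeR prT sK minK.
- exact: addM_submodule.
- by apply: addM_mono => // a; apply: symbolic_power_base.
- by apply: addM_mono => //; apply: symbolic_power_decr.
apply: (symbolic_power_exp_notin (n := n) prP prQ PQ Qy Py).
have /(_ _ (symbolic_power_exp y prP prQ n)) : subM (S n) (saturation T (S n.+1)).
  apply: (nakayama_regular (a := u) (noetherian_acc noeR)) => //.
  - exact: symbolic_power_decr.
  - by move=> v; apply: saturation_saturated.
  - by move=> a Sa; apply/S_stable/addM_subl.
apply: saturation_min => //.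
exact: saturated_mono QT (saturation_saturated prQ).
Qed.

Lemma prime_between P Q T u : prime_ideal P -> prime_ideal Q -> prime_ideal T ->
  strictI P Q -> strictI Q T -> T u ->
  exists Q', [/\ prime_ideal Q', strictI P Q', strictI Q' T & Q' u].
Proof.
move=> prP prQ prT ltPQ ltQT Tu; have [PQ _] := ltPQ.
have [Pu|Pu] := pselect (P u); first by exists Q; split=> //; apply: PQ.
apply: contrapT => no_between.
have minT : minimal_over (adjoinI P [:: u]) T.
  move=> I prI /adjoinI_subP[PI uI] IT a Ta; apply: contrapT => Ia.
  have Iu : I u by apply: uI; apply: mem_head.
  by apply: no_between; exists I; split=> //; split=> //; [exists u | exists a].
have [QT [b [Tb Qb]]] := ltQT.
apply: (krull_principal_ideal prP prQ prT QT Tu _ minT ltPQ) => Qu.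
apply/Qb/(minT Q) => //; apply/adjoinI_subP.
by split=> // a; rewrite inE => /eqP->.
Qed.

Fixpoint prime_chain_to A n P : Prop :=
  prime_ideal P /\
  if n is k.+1 then exists2 Q, prime_chain_to A k Q & strictI Q P else subI A P.

Lemma prime_chain_to_prime A n P : prime_chain_to A n P -> prime_ideal P.
Proof. by case: n => [|n] []. Qed.

Lemma prime_chainP A n : prime_chain A n <-> exists P, prime_chain_to A n P.
Proof.
split=> [[p [prp Ap ltp]]|[P chainP]].
  exists (p n); elim: n prp ltp => [|n IHn] prp ltp; first by split=> //; apply: prp.
  split; first exact: prp.
  exists (p n); last exact: ltp.
  by apply: IHn => i le_in; [apply: prp | apply: ltp]; apply: leqW.
suff [p [prp Ap ltp _]] : exists p : nat -> R -> Prop,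
    [/\ forall i, (i <= n)%N -> prime_ideal (p i), subI A (p 0%N),
        forall i, (i < n)%N -> strictI (p i) (p i.+1) & p n = P] by exists p.
elim: n P chainP => [|n IHn] P /= [prP]; first by exists (fun=> P).
move=> [Q /IHn[p [prp Ap ltp p_n]] ltQP].
exists (fun i => if (i <= n)%N then p i else P); split=> //.
- by move=> i _; case: ifP => // le_in; apply: prp.
- move=> i; rewrite ltnS => le_in; rewrite le_in; case: ltnP => [|le_ni]; first exact: ltp.
  by have -> : i = n; [apply/eqP; rewrite eqn_leq le_in | rewrite p_n].
- by rewrite ltnn.
Qed.

Lemma prime_chain_to_adjoin A n P u : prime_chain_to A n.+1 P -> P u ->
  exists2 Q, prime_chain_to (adjoinI A [:: u]) n Q & subI Q P.
Proof.
elim: n P => [|n IHn] P [prP [Q chainQ ltQP]] Pu.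
  have [[QP _] [_ AQ]] := (ltQP, chainQ); exists P => //; split=> //.
  apply/adjoinI_subP; split=> [a Aa|a]; first exact/QP/AQ.
  by rewrite inE => /eqP->.
have [prQ [Q' chainQ' ltQ'Q]] := chainQ.
have [T [prT ltQ'T [TP [b [Pb Tb]]] Tu]] :=
  prime_between (prime_chain_to_prime chainQ') prQ prP ltQ'Q ltQP Pu.
have [|T' chainT' T'T] := IHn T _ Tu; first by split=> //; exists Q'.
exists P => //; split=> //; exists T' => //; split=> [a /T'T /TP //|].
by exists b; split=> // /T'T.
Qed.

End Krull.

Section Dimension.
Variable R : comNzRingType.
Implicit Types (A B I J P Q : R -> Prop) (z : seq R).

Lemma prime_chain_over A B n : (forall P, prime_ideal P -> subI A P -> subI B P) ->
  prime_chain A n -> prime_chain B n.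
Proof.
by move=> AB [p [prp Ap ltp]]; exists p; split=> //; apply: AB => //; apply: prp.
Qed.

Lemma prime_chain_leq A k n : (k <= n)%N -> prime_chain A n -> prime_chain A k.
Proof.
move=> le_kn [p [prp Ap ltp]]; exists p; split=> // i lt_ik.
  by apply: prp; apply: leq_trans le_kn.
by apply: ltp; apply: leq_trans le_kn.
Qed.

Lemma chain_dim_unique A d e : chain_dim A d -> chain_dim A e -> d = e.
Proof.
move=> [chain_d no_d] [chain_e no_e]; have [lt_de|lt_ed|//] := ltngtP d e.
  by case: no_d; apply: prime_chain_leq chain_e.
by case: no_e; apply: prime_chain_leq chain_d.
Qed.

(* The dimension of [R / A] is at most [n]; this includes the case [R / A = 0]. *)
Definition dim_leq A n : Prop := ~ prime_chain A n.+1.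

Lemma dim_leq_over A B n : (forall P, prime_ideal P -> subI B P -> subI A P) ->
  dim_leq A n -> dim_leq B n.
Proof. by move=> BA dimA /(prime_chain_over BA). Qed.

Lemma dim_leq_sub A B n : subI A B -> dim_leq A n -> dim_leq B n.
Proof. by move=> AB; apply: dim_leq_over => P _ BP a /AB /BP. Qed.

Section LocalRing.
Variable m : R -> Prop.
Hypotheses (noeR : noetherian R) (locR : local_ring m).

Lemma maximal_ideal_exists I : ideal I -> ~ I 1 -> exists2 J, maximal_ideal J & subI I J.
Proof.
move: I; apply: (submodule_noetherian_ind (M := R^o) (noetherian_acc noeR)) => I iI IHI I1.
have [maxI|nmaxI] := pselect (maximal_ideal I); first by exists I.
have [J iJ [J1 ltIJ]] : exists2 J, ideal J & ~ J 1 /\ strictI I J.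
  apply: contrapT => no_J; apply: nmaxI; split=> // J iJ J1 IJ a Ja.
  by apply: contrapT => Ia; apply: no_J; exists J => //; do !split=> //; exists a.
have [J' maxJ' JJ'] := IHI J iJ ltIJ J1.
by exists J' => // a; have [IJ _] := ltIJ; move=> /IJ /JJ'.
Qed.

Lemma local_unit s : ~ m s -> exists t, t * s = 1.
Proof.
move=> ms; have [_ uniq_m] := locR; apply: contrapT => no_inv.
have [||J maxJ sJ] := @maximal_ideal_exists (cyclicM (s : R^o)).
- exact: cyclicM_submodule.
- by move=> [t eq_ts]; apply: no_inv; exists t.
by apply/ms/(uniq_m J maxJ)/sJ; exists 1; rewrite scale1r.
Qed.

Lemma local_prime : prime_ideal m.
Proof.
have [[im m1 _] _] := locR; split=> // a b mab.
have [ma|/local_unit[t ta]] := pselect (m a); [by left | right].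
by rewrite -[b]mul1r -ta -mulrA; apply: ideal_mull.
Qed.

Lemma ideal_sub_local I : ideal I -> ~ I 1 -> subI I m.
Proof.
move=> iI I1 a Ia; apply: contrapT => /local_unit[t ta].
by apply: I1; rewrite -ta; apply: ideal_mull.
Qed.

Lemma ideal_cube_local_prod B a :
  ideal B -> m a -> ideal_cube B a -> ideal_prod m B a.
Proof.
move=> iB ma; have [B1 _|B1] := pselect (B 1).
  by rewrite -[a]mulr1; apply: ideal_prod_mul.
have Bm := ideal_sub_local iB B1.
suff /(_ a) : subI (ideal_cube B) (ideal_prod m B) by [].
apply/gen_ideal_subP; first exact: ideal_prod_ideal.
move=> _ [b [c [e [Bb Bc Be ->]]]].
by apply: ideal_prod_mul => //; apply: Bm; apply: ideal_mull.
Qed.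

Lemma prime_sub_local P : prime_ideal P -> subI P m.
Proof. by case=> iP P1 _; apply: ideal_sub_local. Qed.

Lemma dim_leq0P A : dim_leq A 0 <-> forall P, prime_ideal P -> subI A P -> subI m P.
Proof.
split=> [dimA P prP AP a ma|mA [p [prp Ap /(_ 0%N isT)[_ [a [p1a p0a]]]]]].
  apply: contrapT => Pa; apply: dimA.
  exists (fun i => if i is 0%N then P else m).
  split=> // [[|i] _|[|//] _] //; first exact: local_prime.
  by split; [apply: prime_sub_local | exists a].
apply/p0a/(mA (p 0%N)) => //; first exact: prp.
by apply: prime_sub_local p1a; apply: prp.
Qed.

Lemma prime_chain_adjoin A u n : m u ->
  prime_chain A n.+1 -> prime_chain (adjoinI A [:: u]) n.
Proof.
move=> mu /prime_chainP[P [prP [Q chainQ [QP [a [Pa Qa]]]]]].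
have chain_m : prime_chain_to A n.+1 m.
  split; first exact: local_prime.
  have Pm := prime_sub_local prP.
  by exists Q => //; split=> [b /QP /Pm //|]; exists a; split=> //; apply: Pm.
have [Q' chainQ' _] := prime_chain_to_adjoin noeR chain_m mu.
by apply/prime_chainP; exists Q'.
Qed.

Lemma prime_chain_adjoin_seq A z n : (forall a, a \in z -> m a) ->
  prime_chain A (n + size z) -> prime_chain (adjoinI A z) n.
Proof.
elim: z A => [|u z IHz] A mz /=.
  by rewrite addn0; apply: prime_chain_over => P _ AP; apply/adjoinI_subP.
rewrite addnS => /(prime_chain_adjoin (mz u (mem_head u z))) /IHz.
by rewrite adjoinI_cat; apply=> a az; apply: mz; rewrite inE az orbT.
Qed.

Lemma dim_leq_adjoin_seq A z n : (forall a, a \in z -> m a) ->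
  dim_leq (adjoinI A z) n -> dim_leq A (n + size z).
Proof. by move=> mz dimAz /(prime_chain_adjoin_seq (n := n.+1) mz). Qed.

Lemma prime_chain_extend A B n :
  (forall P, prime_ideal P -> subI B P -> ~ subI m P ->
     exists Q, [/\ prime_ideal Q, subI A Q & strictI Q P]) ->
  prime_chain B n.+1 -> prime_chain A n.+2.
Proof.
move=> extend [p [prp Bp ltp]]; have [_ [b [p1b p0b]]] := ltp 0%N isT.
have mp0 : ~ subI m (p 0%N).
  by move=> mp0; apply/p0b/mp0; apply: prime_sub_local p1b; apply: prp.
have [Q [prQ AQ ltQ]] := extend _ (prp 0%N isT) Bp mp0.
exists (fun i => if i is j.+1 then p j else Q); split=> // [[|i] lt_i|[|i] lt_i] //.
  exact: prp.
exact: ltp.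
Qed.

Lemma dim_avoidance (As : seq (R -> Prop)) J : ideal J ->
  (forall A, A \in As -> forall P, prime_ideal P -> subI A P -> ~ subI m P -> ~ subI J P) ->
  exists2 a, J a & forall A, A \in As -> forall n,
    dim_leq A n.+1 -> dim_leq (adjoinI A [:: a]) n.
Proof.
move=> iJ AsJ.
have [minp minpP] := choice (fun A => minimal_primes noeR (gen_ideal_ideal A)).
pose Ps := [seq Q <- flatten [seq minp A | A <- As] | ~~ `[< subI m Q >]].
have [Q|a Ja avoid_a] := prime_avoidance (Ps := Ps) iJ.
  rewrite mem_filter => /andP[/asboolPn mQ /flatten_mapP[A As_A]].
  case/(minpP A).1 => prQ /gen_ideal_subP AQ; split=> //.
  by apply: (AsJ A) => //; apply: AQ; case: prQ.
exists a => // A As_A n dimA chain_a; apply: dimA; apply: prime_chain_extend chain_a.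
move=> P prP /adjoinI_subP[AP aP] mP; have [iP _ _] := prP.
have [Q minQ QP] : exists2 Q, Q \in minp A & subI Q P.
  by apply: (minpP A).2 => //; apply/gen_ideal_subP.
have [prQ /gen_ideal_subP AQ] := (minpP A).1 Q minQ.
exists Q; split=> //; first by apply: AQ; case: prQ.
split=> //; exists a; split; first exact/aP/mem_head.
apply: avoid_a; rewrite mem_filter; apply/andP; split.
  by apply/asboolPn => mQ; apply: mP => b /mQ /QP.
by apply/flatten_mapP; exists A.
Qed.

End LocalRing.
End Dimension.

Lemma prod_congr (R : comNzRingType) (I : R -> Prop) (J : finType) (F G : J -> R) :
  ideal I -> (forall i, I (F i - G i)) -> I (\prod_i F i - \prod_i G i).
Proof.
move=> iI IFG; elim/big_rec2: _ => [|i x y _ Ixy]; first by rewrite subrr; case: iI.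
have -> : F i * y - G i * x = F i * (y - x) + (F i - G i) * x by ring.
by apply/ideal_addl => //; [apply: ideal_mull | apply: ideal_mulr].
Qed.

Lemma det_congr (R : comNzRingType) (I : R -> Prop) n (A B : 'M[R]_n) : ideal I ->
  (forall i j, I (A i j - B i j)) -> I (\det A - \det B).
Proof.
move=> iI IAB; rewrite /determinant -sumrB.
apply: (submod_sum (M := R^o)) => // s; rewrite -mulrBr.
by apply: ideal_mull => //; apply: prod_congr.
Qed.

Section ResidueDimension.
Variables (R : comNzRingType) (m : R -> Prop).
Hypotheses (noeR : noetherian R) (locR : local_ring m).

Lemma mulmx_congr1_min n p (A : 'M[R]_(p, n)) (B : 'M[R]_(n, p)) :
  (forall j k, m ((1%:M : 'M_p) j k - (A *m B) j k)) -> (p <= n)%N.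
Proof.
move=> AB1; have [im m1 _] := local_prime noeR locR.
have [|t t_det] := local_unit noeR locR (s := \det (A *m B)).
  move=> m_det; apply: m1; have := det_congr im AB1.
  by rewrite det1 => /ideal_addr; apply => //; rewrite -mulN1r; apply: ideal_mull.
apply: (@mulmx1_min R p n A (B *m (t *: \adj (A *m B)))).
by rewrite mulmxA -scalemxAr mul_mx_adj scale_scalar_mx t_det.
Qed.

Section Module.
Variable M : lmodType R.
Implicit Types (N P Q K : M -> Prop).

(* [n] is the dimension of [N / Q] over the residue field, given by a basis of
   representatives; [socle_kdim m Q] is [residue_dim (socle m Q) Q]. *)
Definition residue_dim N Q n : Prop := exists v : 'I_n -> M,
  [/\ forall i, N (v i),
      forall w, N w -> exists c : 'I_n -> R, Q (w - \sum_(i < n) c i *: v i) &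
      forall c : 'I_n -> R, Q (\sum_(i < n) c i *: v i) -> forall i, m (c i)].

Lemma residue_dim0 N Q : subM N Q -> residue_dim N Q 0.
Proof.
move=> NQ; exists (fun=> 0); split=> [[]//|w Nw|c _ []//].
by exists (fun=> 0); rewrite big_ord0 subr0; apply: NQ.
Qed.

Lemma residue_dim_adjoin Q v : submodule Q -> ~ Q v ->
  residue_dim (adjoinM Q v) Q 1.
Proof.
move=> sQ Qv; exists (fun=> v); split=> [_|_ [q [_ [Qq [t ->] ->]]]|c].
- exact: adjoinM_id.
- by exists (fun=> t); rewrite big_ord1 addrK.
rewrite big_ord1 => Qcv i; rewrite (ord1 i).
apply: contrapT => /(local_unit noeR locR)[t tc]; apply: Qv.
by rewrite -[v]scale1r -tc -scalerA; apply: submodZ.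
Qed.

Lemma residue_dimD N P Q p q : submodule P -> submodule Q -> subM Q P -> subM P N ->
  subM N (colonM Q m) -> residue_dim P Q p -> residue_dim N P q -> residue_dim N Q (p + q).
Proof.
move=> sP sQ QP PN mNQ [u [Pu span_u free_u]] [v [Nv span_v free_v]].
pose cat T (f : 'I_p -> T) g (i : 'I_(p + q)) : T :=
  match split i with inl j => f j | inr j => g j end.
have catl T (f : 'I_p -> T) g i : cat T f g (lshift q i) = f i.
  by rewrite /cat (unsplitK (inl i)).
have catr T (f : 'I_p -> T) g i : cat T f g (rshift p i) = g i.
  by rewrite /cat (unsplitK (inr i)).
have sum_cat c : \sum_i c i *: cat M u v i =
    \sum_i c (lshift q i) *: u i + \sum_i c (rshift p i) *: v i.
  by rewrite big_split_ord; congr (_ + _); apply: eq_bigr => i _; rewrite ?catl ?catr.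
exists (cat M u v); split=> [i|w Nw|c].
- by rewrite /cat; case: split => j; [apply: PN | apply: Nv].
- have [c Pc] := span_v w Nw; have [d Qd] := span_u _ Pc.
  exists (cat R d c); rewrite sum_cat; under eq_bigr do rewrite catl.
  under [X in _ - (_ + X)]eq_bigr do rewrite catr.
  by rewrite opprD addrCA addrC.
rewrite sum_cat => Qc.
have Pu_c : P (\sum_i c (lshift q i) *: u i) by apply: submod_lincomb.
have m_r : forall i, m (c (rshift p i)).
  by apply: (free_v (fun i => c (rshift p i))); apply/(submodDl _ sP Pu_c)/QP.
have m_l : forall i, m (c (lshift q i)).
  have Qv_c : Q (\sum_i c (rshift p i) *: v i) by apply: submod_sum => // i; apply: mNQ.
  by apply: (free_u (fun i => c (lshift q i))); apply/(submodDr _ sQ Qv_c).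
by move=> i; rewrite -(splitK i); case: split => j /=.
Qed.

Lemma residue_dim_exists N Q : acc_submodules M -> submodule N -> submodule Q ->
  subM Q N -> subM N (colonM Q m) -> exists n, residue_dim N Q n.
Proof.
move=> acc sN sQ.
move: Q sQ; apply: submodule_noetherian_ind => // Q sQ IHQ QN mNQ.
have [NQ|/existsPNP[v Nv Qv]] := pselect (subM N Q).
  by exists 0%N; apply: residue_dim0.
have sQv := adjoinM_submodule v sQ.
have QvN : subM (adjoinM Q v) N by apply: adjoinM_min.
have [|n dimN] := IHQ _ sQv (adjoinM_strict sQ Qv) QvN.
  by move=> w Nw a ma; apply/adjoinM_sub/mNQ.
exists (1 + n)%N; apply: residue_dimD dimN => //; first exact: adjoinM_sub.
exact: residue_dim_adjoin.
Qed.

Lemma residue_dim_leq N Q n p : submodule Q ->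
  residue_dim N Q n -> residue_dim N Q p -> (p <= n)%N.
Proof.
move=> sQ [v [Nv span_v _]] [w [Nw span_w free_w]].
have [C QC] := choice (fun j => span_v (w j) (Nw j)).
have [D QD] := choice (fun i => span_w (v i) (Nv i)).
pose A := \matrix_(j < p, i < n) C j i; pose B := \matrix_(i < n, k < p) D i k.
have AB1 j k : m ((1%:M : 'M_p) j k - (A *m B) j k).
  apply: (free_w (fun k => (1%:M : 'M_p) j k - (A *m B) j k)).
  have sum_AB : \sum_i C j i *: (v i - \sum_k D i k *: w k) =
      \sum_i C j i *: v i - \sum_k (A *m B) j k *: w k.
    under eq_bigr do rewrite scalerBr scaler_sumr; rewrite sumrB exchange_big.
    congr (_ - _); apply: eq_bigr => k' _; rewrite mxE scaler_suml.
    by apply: eq_bigr => i _; rewrite !mxE scalerA.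
  have -> : \sum_k ((1%:M : 'M_p) j k - (A *m B) j k) *: w k =
      (w j - \sum_i C j i *: v i) + \sum_i C j i *: (v i - \sum_k D i k *: w k).
    under eq_bigr do rewrite scalerBl; rewrite sumrB sum_AB addrA subrK.
    rewrite (bigD1 j) //= mxE eqxx scale1r big1 ?addr0 // => k' /negPf j'k.
    by rewrite mxE eq_sym j'k scale0r.
  by apply: submodD => //; apply: submod_lincomb.
exact: (mulmx_congr1_min AB1).
Qed.

Lemma residue_dim_unique N Q n p : submodule Q ->
  residue_dim N Q n -> residue_dim N Q p -> n = p.
Proof.
move=> sQ dim_n dim_p; apply/eqP; rewrite eqn_leq.
by rewrite (residue_dim_leq sQ dim_n dim_p) (residue_dim_leq sQ dim_p dim_n).
Qed.

End Module.

(* The relation [S (f v - g v')] between [v] and [v'] induces an isomorphism from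
   [N / Q] to [N' / Q']. *)
Lemma residue_dim_correspondence (M M' L : lmodType R) (f : {linear M -> L})
    (g : {linear M' -> L}) (S : L -> Prop) (N Q : M -> Prop) (N' Q' : M' -> Prop) n :
  submodule S -> submodule N -> submodule N' ->
  (forall v, N v -> exists2 v', N' v' & S (f v - g v')) ->
  (forall v', N' v' -> exists2 v, N v & S (f v - g v')) ->
  (forall v v', N v -> N' v' -> S (f v - g v') -> Q v <-> Q' v') ->
  residue_dim N Q n -> residue_dim N' Q' n.
Proof.
move=> sS sN sN' to from SQ [v [Nv span_v free_v]].
have [v' N'v' Sv] := fin_all_exists2 (fun i => to (v i) (Nv i)).
have S_sum (c : 'I_n -> R) : S (f (\sum_i c i *: v i) - g (\sum_i c i *: v' i)).
  rewrite (linear_sum f) (linear_sum g) -sumrB; apply: submod_sum => // i.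
  by rewrite (linearZZ f) (linearZZ g) -scalerBr; apply: submodZ.
have N_sum (c : 'I_n -> R) : N (\sum_i c i *: v i) by apply: submod_lincomb.
have N'_sum (c : 'I_n -> R) : N' (\sum_i c i *: v' i) by apply: submod_lincomb.
exists v'; split=> // [w' N'w'|c Q'c].
  have [w Nw Sw] := from w' N'w'; have [c Qc] := span_v w Nw.
  exists c; apply/(SQ (w - \sum_i c i *: v i)) => //; try exact: submodB.
  by rewrite (linearB f) (linearB g) subrACA; apply: submodB.
by apply: free_v; apply/(SQ _ _ _ _ (S_sum c)).
Qed.

End ResidueDimension.

Section Socle.
Variables (R : comNzRingType) (M : lmodType R) (m : R -> Prop).
Implicit Types (N K : M -> Prop) (a b r : R) (v w : M).

Lemma socle_addM_scaleP N a v : socle m (addM N (scaleM a)) v <->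
  forall r, m r -> exists w, N (r *: v - a *: w).
Proof. by split=> soc_v r /soc_v /addM_scaleP. Qed.

Section RegularElements.
Variable N : M -> Prop.
Hypothesis sN : submodule N.

Lemma socle_addM_scale_transfer a b v : m b -> regular_mod N a ->
  socle m (addM N (scaleM a)) v ->
  exists2 w, socle m (addM N (scaleM b)) w & N (b *: v - a *: w).
Proof.
move=> mb reg_a /socle_addM_scaleP soc_v; have [w Nw] := soc_v b mb.
exists w => //; apply/socle_addM_scaleP => r mr; have [u Nu] := soc_v r mr.
exists u; apply: reg_a.
have -> : a *: (r *: w - b *: u) = b *: (r *: v - a *: u) - r *: (b *: v - a *: w).
  rewrite !scalerBr [b *: (r *: v)]scalerC [b *: (a *: u)]scalerC.
  by rewrite subrACA subrr sub0r opprB [a *: (r *: w)]scalerC.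
by apply: submodB => //; apply: submodZ.
Qed.

Lemma addM_scale_transfer a b v w : regular_mod N a -> N (b *: v - a *: w) ->
  addM N (scaleM a) v -> addM N (scaleM b) w.
Proof.
move=> reg_a Nvw /addM_scaleP[u Nu]; apply/addM_scaleP; exists u; apply: reg_a.
have -> : a *: (w - b *: u) = b *: (v - a *: u) - (b *: v - a *: w).
  by rewrite !scalerBr [a *: (b *: u)]scalerC subrACA subrr sub0r opprB.
by apply: submodB => //; apply: submodZ.
Qed.

Lemma socle_kdim_regular a b n : m a -> m b -> regular_mod N a -> regular_mod N b ->
  socle_kdim m (addM N (scaleM a)) n -> socle_kdim m (addM N (scaleM b)) n.
Proof.
move=> ma mb reg_a reg_b.
have sNa c := addM_submodule sN (scaleM_submodule M c).
apply: (residue_dim_correspondence (f := *:%R b) (g := *:%R a) sN).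
- exact/colonM_submodule/sNa.
- exact/colonM_submodule/sNa.
- by move=> v; apply: socle_addM_scale_transfer.
- move=> w /(socle_addM_scale_transfer ma reg_b)[v soc_v Nwv].
  by exists v; last exact: submodBC.
- move=> v w _ _ Nvw; split; first exact: addM_scale_transfer Nvw.
  by apply: addM_scale_transfer => //; apply: submodBC.
Qed.

End RegularElements.

Section Colon.
Variables (K : M -> Prop) (B : R -> Prop).
Hypotheses (sK : submodule K) (iB : ideal B).
Local Notation H := (colonM K B).
Let sH : submodule H := colonM_submodule B sK.

Section Sequence.
Variable a : R.
Hypotheses (mBa : ideal_prod m B a) (reg_a : regular_mod H a).

Let Ba : B a := ideal_prod_subr iB mBa.

Lemma addM_scale_cap_colon h : addM K (scaleM a) h -> H h -> K h.
Proof.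
move=> /addM_scaleP[x Khx] Hh.
have Hx : H x.
  have Hhx : H (h - a *: x) by apply: colonM_sub.
  by apply: reg_a; apply/(submod_congr sH Hhx).
by apply/(submod_congr sK Khx)/Hx.
Qed.

(* If [r *: v] is [a *: n r] modulo [H] for [r] in [m], we look for a [w] such that
   [r *: w] is [c *: n r] modulo [K]. For [c = r0 * b] in [m B], [w := b *: n r0] works; the
   socle lift is the case [c = a]. *)
Definition lift_multiplier v c : Prop := exists2 w, H (a *: w - c *: v) &
  forall r n, m r -> H (r *: v - a *: n) -> K (r *: w - c *: n).

Lemma lift_multiplier_ideal v : ideal (lift_multiplier v).
Proof.
split=> [|c c' [w Hw Kw] [w' Hw' Kw']|t c [w Hw Kw]].
- exists 0 => [|r n _ _]; rewrite scaler0 scale0r subr0; first exact: (submod0 sH).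
  exact: (submod0 sK).
- exists (w + w') => [|r n mr Hn]; rewrite scalerDr scalerDl opprD addrACA.
    exact: (submodD sH).
  by apply: submodD => //; [apply: Kw | apply: Kw'].
- exists (t *: w) => [|r n mr Hn]; rewrite scalerC -scalerA -scalerBr.
    exact: (submodZ t sH).
  by apply: submodZ => //; apply: Kw.
Qed.

Lemma lift_multiplier_prod v : socle m (addM H (scaleM a)) v ->
  subI (ideal_prod m B) (lift_multiplier v).
Proof.
move=> /socle_addM_scaleP soc_v; apply/gen_ideal_subP; first exact: lift_multiplier_ideal.
move=> _ [r0 [b [mr0 Bb ->]]]; have [n0 Hn0] := soc_v r0 mr0.
exists (b *: n0) => [|r n mr Hn]; rewrite [r0 * b]mulrC -scalerA scalerC -scalerBr.
  by apply: (submodZ b sH); apply: (submodBC sH).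
suff: H (r *: n0 - r0 *: n) by apply.
apply: reg_a.
have -> : a *: (r *: n0 - r0 *: n) = r0 *: (r *: v - a *: n) - r *: (r0 *: v - a *: n0).
  rewrite !scalerBr subrACA [r0 *: (r *: v)]scalerC subrr sub0r opprB.
  by rewrite [a *: (r *: n0)]scalerC [a *: (r0 *: n)]scalerC.
by apply: (submodB sH); apply: (submodZ _ sH).
Qed.

Lemma socle_lift v : socle m (addM H (scaleM a)) v ->
  exists2 w, socle m (addM K (scaleM a)) w & H (w - v).
Proof.
move=> soc_v; have [w Hw Kw] := lift_multiplier_prod soc_v mBa.
exists w; last by apply: reg_a; rewrite scalerBr.
apply/socle_addM_scaleP => r mr; have [n Hn] := (socle_addM_scaleP _ _ _).1 soc_v r mr.
by exists n; apply: Kw.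
Qed.

Let sa := scaleM_submodule M a.
Let sKa := addM_submodule sK sa.
Let sHa := addM_submodule sH sa.
Let KaHa : subM (addM K (scaleM a)) (addM H (scaleM a)).
Proof. by apply: addM_mono => //; apply: colonM_sub. Qed.

Lemma residue_dim_socle_kernel p : residue_dim m (capM (socle m K) H) K p ->
  residue_dim m (capM (socle m (addM K (scaleM a))) (addM H (scaleM a)))
    (addM K (scaleM a)) p.
Proof.
apply: (residue_dim_correspondence (f := idfun) (g := idfun) sKa) => //.
- by apply: capM_submodule => //; apply: colonM_submodule.
- by apply: capM_submodule => //; apply: colonM_submodule.
- move=> h [soc_h Hh]; exists h; last by rewrite subrr; apply: submod0.
  split; last exact: addM_subl.
  by move=> r mr; apply: addM_subl => //; apply: soc_h.
- move=> v [soc_v [h [l [Hh [x ->] def_v]]]].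
  have Kahv : addM K (scaleM a) (h - v).
    by rewrite def_v opprD addrA subrr sub0r -scalerN; apply: addM_subr => //; exists (- x).
  exists h => //; split=> // r mr; apply: addM_scale_cap_colon; last exact: (submodZ r sH).
  have Kahv_r : addM K (scaleM a) (r *: h - r *: v) by rewrite -scalerBr; apply: submodZ.
  exact/(submod_congr sKa Kahv_r)/soc_v.
move=> h v [_ Hh] _ Kahv; rewrite -(submod_congr sKa Kahv).
by split=> [Kh|/addM_scale_cap_colon]; [apply: addM_subl | apply].
Qed.

Lemma residue_dim_socle_image q : socle_kdim m (addM H (scaleM a)) q ->
  residue_dim m (socle m (addM K (scaleM a)))
    (capM (socle m (addM K (scaleM a))) (addM H (scaleM a))) q.
Proof.
apply: (residue_dim_correspondence (f := idfun) (g := idfun) sHa).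
- exact: colonM_submodule.
- exact: colonM_submodule.
- move=> v /socle_lift[w soc_w Hwv]; exists w => //.
  by apply: submodBC => //; apply: addM_subl.
- move=> w soc_w; exists w; last by rewrite subrr; apply: submod0.
  by move=> r /soc_w /KaHa.
move=> v w _ soc_w Hvw; rewrite (submod_congr sHa Hvw).
by split=> // -[].
Qed.

Lemma socle_kdim_addM_scale p q : residue_dim m (capM (socle m K) H) K p ->
  socle_kdim m (addM H (scaleM a)) q -> socle_kdim m (addM K (scaleM a)) (p + q).
Proof.
move=> /residue_dim_socle_kernel dim_p /residue_dim_socle_image dim_q.
apply: residue_dimD dim_p dim_q => //.
- by apply: capM_submodule => //; apply: colonM_submodule.
- by move=> v Kv; split; [apply: colonM_sub | apply: KaHa].
- by move=> v [].
Qed.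

End Sequence.

Lemma socle_kdim_exchange a b n : noetherian R -> local_ring m -> acc_submodules M ->
  ideal_prod m B a -> ideal_prod m B b -> regular_mod H a -> regular_mod H b ->
  socle_kdim m (addM K (scaleM a)) n -> socle_kdim m (addM K (scaleM b)) n.
Proof.
move=> noeR locR acc mBa mBb reg_a reg_b dim_n.
have [im _ _] := local_prime noeR locR.
have mB_m := ideal_prod_subl (J := B) im.
have sHa := addM_submodule sH (scaleM_submodule M a).
have [p dim_p] : exists p, residue_dim m (capM (socle m K) H) K p.
  apply: residue_dim_exists => // [|v Kv|v []//].
    by apply: capM_submodule => //; apply: colonM_submodule.
  by split; apply: colonM_sub.
have [q dim_q] : exists q, socle_kdim m (addM H (scaleM a)) q.
  by apply: residue_dim_exists => //; [apply: colonM_submodule | apply: colonM_sub].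
have dim_a := socle_kdim_addM_scale mBa reg_a dim_p dim_q.
have sKa := addM_submodule sK (scaleM_submodule M a).
rewrite (residue_dim_unique noeR locR sKa dim_n dim_a).
apply: socle_kdim_addM_scale => //.
by apply: socle_kdim_regular dim_q => //; apply: mB_m.
Qed.

End Colon.
End Socle.

Section SubGen.
Variables (R : comNzRingType) (M : lmodType R).
Implicit Types (K N L : M -> Prop) (s t z : seq R) (a : R).

Lemma sub_gen_submodule K z : submodule (sub_gen K z).
Proof.
split=> [N sN _ _|u v Ku Kv N sN KN zN|r v Kv N sN KN zN]; first exact: submod0.
  by apply: submodD => //; [apply: Ku | apply: Kv].
by apply: submodZ => //; apply: Kv.
Qed.

Lemma sub_gen_sub K z : subM K (sub_gen K z).
Proof. by move=> v Kv N _ KN _; apply: KN. Qed.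

Lemma sub_gen_mem K z a w : a \in z -> sub_gen K z (a *: w).
Proof. by move=> /(nthP 0)[j lt_j <-] N _ _; apply. Qed.

Lemma sub_gen_min K z N : submodule N -> subM K N ->
  (forall a w, a \in z -> N (a *: w)) -> subM (sub_gen K z) N.
Proof. by move=> sN KN zN v; apply=> // j w lt_j; apply/zN/mem_nth. Qed.

Lemma sub_gen_mono K s t : {subset s <= t} -> subM (sub_gen K s) (sub_gen K t).
Proof.
move=> st; apply: sub_gen_min => [||a w /st]; first exact: sub_gen_submodule.
  exact: sub_gen_sub.
exact: sub_gen_mem.
Qed.

Lemma eq_mem_sub_gen K s t : s =i t -> sub_gen K s = sub_gen K t.
Proof. by move=> st; apply: subM_antisym; apply: sub_gen_mono => a; rewrite st. Qed.

Lemma sub_gen_cons K a z : sub_gen K (a :: z) = addM (sub_gen K z) (scaleM a).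
Proof.
have [sKaz sKz] := (sub_gen_submodule K (a :: z), sub_gen_submodule K z).
have sa := scaleM_submodule M a; apply: subM_antisym.
- apply: sub_gen_min; first exact: addM_submodule.
    by move=> v Kv; apply: addM_subl => //; apply: sub_gen_sub.
  move=> b w; rewrite inE => /predU1P[->|bz]; first by apply: addM_subr => //; exists w.
  by apply: addM_subl => //; apply: sub_gen_mem.
- apply: addM_min => // [|_ [w ->]]; last by apply: sub_gen_mem; apply: mem_head.
  apply: sub_gen_min => // [|b w bz]; first exact: sub_gen_sub.
  by apply: sub_gen_mem; rewrite inE bz orbT.
Qed.

Lemma sub_gen_cat K s t : sub_gen K (s ++ t) = sub_gen (sub_gen K t) s.
Proof.
elim: s => [|a s IHs] /=; last by rewrite !sub_gen_cons IHs.
apply: subM_antisym; first exact: sub_gen_sub.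
by apply: sub_gen_min => //; apply: sub_gen_submodule.
Qed.

Lemma sub_gen_insert K z a t :
  sub_gen K (z ++ a :: t) = addM (sub_gen (sub_gen K t) z) (scaleM a).
Proof.
rewrite (eq_mem_sub_gen K (t := a :: z ++ t)) ?sub_gen_cons ?sub_gen_cat // => b.
by rewrite mem_insert mem_rcons.
Qed.

Variable m : R -> Prop.

Lemma bideal_ideal K : ideal (bideal m K).
Proof.
split=> [z _ i _ v _|a b Ba Bb z sop_z i lt_i v zv|r a Ba z sop_z i lt_i v zv];
  have sKz := sub_gen_submodule K (take i z).
- by rewrite scale0r; apply: submod0.
- by rewrite scalerDl; apply: (submodD sKz); [apply: Ba zv | apply: Bb zv].
- by rewrite -scalerA; apply: (submodZ _ sKz); apply: Ba zv.
Qed.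

Lemma ann_quot_bideal K : subI (ann_quot K) (bideal m K).
Proof. by move=> a aK z _ i _ v _; apply: sub_gen_sub; apply: aK. Qed.

Lemma sop_bideal_colon K z a : sop m K (rcons z a) ->
  forall v, sub_gen K z (a *: v) -> colonM (sub_gen K z) (bideal m K) v.
Proof.
move=> sop_za v Kav b /(_ _ sop_za (size z)).
rewrite size_rcons leqnn -cats1 take_size_cat // nth_cat ltnn subnn /=.
exact.
Qed.

End SubGen.

Section SystemsOfParameters.
Variables (R : comNzRingType) (M : lmodType R) (m : R -> Prop).
Hypotheses (noeR : noetherian R) (locR : local_ring m) (fgM : fin_gen M).
Implicit Types (K N : M -> Prop) (t z : seq R) (P : R -> Prop).

Let accM : acc_submodules M := fin_gen_acc noeR fgM.
Let prm : prime_ideal m := local_prime noeR locR.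

Lemma saturated_local N : submodule N -> saturated m N.
Proof.
move=> sN s v /(local_unit noeR locR)[t ts] Nsv.
by rewrite -[v]scale1r -ts -scalerA; apply: submodZ.
Qed.

Lemma dim0_finite_length K : submodule K -> dim_leq (ann_quot K) 0 -> finite_length K.
Proof.
move=> sK /(dim_leq0P noeR locR) dimK; have satK := saturated_local sK.
have [|b lenK] := local_length_exists accM noeR prm sK satK.
  by move=> P prP annP _; apply: dimK.
exists b => k N CN; apply: (local_length_chains_bounded prm lenK sK satK).
by move=> i /CN[sN KN]; split=> //; apply: saturated_local.
Qed.

Lemma torsion_annihilator P K : prime_ideal P -> submodule K ->
  (forall v, saturation P K v) -> exists2 s, ~ P s & ann_quot K s.
Proof.
move=> prP sK tors; have [g full] := fin_gen_spanM fgM.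
suff [s Ps sK_g] : exists2 s, ~ P s & forall v, spanM g v -> K (s *: v).
  by exists s => // v; apply: sK_g.
elim: g {full} => [|w g [s Ps sK_g]] /=.
  by exists 1 => [|_ ->]; [case: prP | rewrite scaler0; apply: submod0].
have [t Pt Ktw] := tors w; exists (s * t) => [|_ [n [_ [/sK_g Ksn [c ->] ->]]]].
  exact: prime_mul_notin.
rewrite scalerDr; apply: submodD => //.
  by rewrite mulrC -scalerA; apply: submodZ.
by rewrite -scalerA [t *: _]scalerC; do 2!apply: submodZ => //.
Qed.

Lemma prime_ann_quot_sub_gen P K z : prime_ideal P -> submodule K ->
  subI (adjoinI (ann_quot K) z) P -> subI (ann_quot (sub_gen K z)) P.
Proof.
move=> prP sK /adjoinI_subP[annP zP] c cM; apply: contrapT => Pc.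
have [v|s Ps /annP//] := torsion_annihilator prP sK.
apply: (nakayama (N := fun=> True)) => // {}v _; exists c => //.
have sPM := mulM_submodule P (fun _ : M => True).
move: (cM v); apply: sub_gen_min; first exact: addM_submodule.
  exact: addM_subl.
by move=> a w /zP Pa; apply: addM_subr => //; apply: mulM_mem.
Qed.

Lemma finite_length_dim0 K z : submodule K -> finite_length (sub_gen K z) ->
  dim_leq (adjoinI (ann_quot K) z) 0.
Proof.
move=> sK [b bounded]; apply/(dim_leq0P noeR locR) => P prP annP a ma.
pose Q := sub_gen K z; have sQ : submodule Q by exact: sub_gen_submodule.
pose D n := addM Q (scaleM (a ^+ n)).
have sD n : submodule (D n) by apply/addM_submodule/scaleM_submodule.
have [n|n|n D_stable] :=
    chains_bounded_dcc (C := fun N => submodule N /\ subM Q N) (D := D) bounded.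
- by split=> //; apply/addM_subl/scaleM_submodule.
- by apply: addM_mono => //; apply: scaleM_exp.
have D_sub_sat : subM (D n) (saturation m Q).
  apply: nakayama => // v /D_stable[q [_ [Qq [w ->] ->]]].
  apply: saturation_sub => //; exists q, (a ^+ n.+1 *: w); split=> //.
  rewrite exprS -scalerA; apply: mulM_mem => //.
  by apply: addM_subr => //; exists w.
apply: (prime_exp (n := n) prP); apply: (prime_ann_quot_sub_gen prP sK annP) => v.
apply: (saturation_min (saturated_local sQ) (fun _ => id)); apply: D_sub_sat.
by apply: addM_subr => //; exists v.
Qed.

Section Submodule.
Variable K : M -> Prop.
Hypothesis sK : submodule K.

Lemma sop_sub_gen t z : module_dim K (size z + size t) ->
  (forall a, a \in z ++ t -> m a) -> dim_leq (adjoinI (ann_quot K) (z ++ t)) 0 ->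
  sop m (sub_gen K t) z.
Proof.
move=> [chain _] m_zt dimK.
have mz a : a \in z -> m a by move=> az; apply: m_zt; rewrite mem_cat az.
have mt a : a \in t -> m a by move=> ta; apply: m_zt; rewrite mem_cat ta orbT.
have dimKt : dim_leq (adjoinI (ann_quot (sub_gen K t)) z) 0.
  apply: dim_leq_sub dimK; apply/adjoinI_subP; split=> [a aK|a].
    by left=> v; apply: sub_gen_sub; apply: aK.
  by rewrite mem_cat => /orP[az|ta]; [right | left=> v; apply: sub_gen_mem].
split=> [|j lt_j|].
- split; last by rewrite -[size z]add0n; apply: (dim_leq_adjoin_seq noeR locR).
  apply: prime_chain_over (prime_chain_adjoin_seq noeR locR mt chain) => P prP.
  exact: prime_ann_quot_sub_gen.
- exact/mz/mem_nth.
apply: dim0_finite_length; first exact: sub_gen_submodule.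
apply: dim_leq_sub dimKt; apply/adjoinI_subP; split=> [a aKt v|a az v].
  by apply: sub_gen_sub; apply: aKt.
exact: sub_gen_mem.
Qed.

Lemma regular_mod_bideal_colon t z a : module_dim K (size z + size t).+1 ->
  (forall c, c \in z ++ a :: t -> m c) ->
  dim_leq (adjoinI (ann_quot K) (z ++ a :: t)) 0 ->
  ideal_prod m (bideal m (sub_gen K t)) a ->
  regular_mod (colonM (sub_gen (sub_gen K t) z) (bideal m (sub_gen K t))) a.
Proof.
move=> dimK m_zat dimKz mBa v Hav; have iB := bideal_ideal m (sub_gen K t).
have ma : m a by apply: m_zat; rewrite mem_cat mem_head orbT.
apply: (@sop_bideal_colon _ _ _ _ _ (a * a)); last first.
  by rewrite -scalerA; apply: Hav; apply: ideal_prod_subr mBa.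
apply: sop_sub_gen => [|c|]; rewrite ?size_rcons ?cat_rcons ?addSn //.
  rewrite mem_insert mem_rcons inE => /predU1P[->|c_zt].
    by apply: ideal_mull; case: prm.
  by apply: m_zat; rewrite mem_insert mem_rcons inE c_zt orbT.
apply: dim_leq_over dimKz => P prP /adjoinI_subP[annP zaP].
apply/adjoinI_subP; split=> // c; rewrite mem_insert mem_rcons inE => /predU1P[->|c_zt].
  by apply: (prime_exp (n := 2) prP); apply: zaP; rewrite mem_cat mem_head orbT.
by apply: zaP; rewrite mem_insert mem_rcons inE c_zt orbT.
Qed.

Lemma socle_kdim_parameter_exchange t z a b n : module_dim K (size z + size t).+1 ->
  (forall c, c \in z ++ t -> m c) ->
  ideal_prod m (bideal m (sub_gen K t)) a -> ideal_prod m (bideal m (sub_gen K t)) b ->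
  dim_leq (adjoinI (ann_quot K) (z ++ a :: t)) 0 ->
  dim_leq (adjoinI (ann_quot K) (z ++ b :: t)) 0 ->
  socle_kdim m (sub_gen K (z ++ a :: t)) n -> socle_kdim m (sub_gen K (z ++ b :: t)) n.
Proof.
move=> dimK m_zt mBa mBb dim_a dim_b; rewrite !sub_gen_insert.
have iB := bideal_ideal m (sub_gen K t); have [im _ _] := prm.
have m_zct c : ideal_prod m (bideal m (sub_gen K t)) c ->
    forall e, e \in z ++ c :: t -> m e.
  move=> mBc e; rewrite mem_insert mem_rcons inE => /predU1P[->|/m_zt//].
  exact: ideal_prod_subl mBc.
apply: (socle_kdim_exchange _ iB noeR locR accM mBa mBb).
- exact: sub_gen_submodule.
- by apply: regular_mod_bideal_colon => //; apply: m_zct.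
- by apply: regular_mod_bideal_colon => //; apply: m_zct.
Qed.

End Submodule.
End SystemsOfParameters.

Section CSystems.
Variables (R : comNzRingType) (M : lmodType R) (m : R -> Prop).
Hypotheses (noeR : noetherian R) (locR : local_ring m) (fgM : fin_gen M).
Implicit Types (x z : seq R) (A J P : R -> Prop).

Let prm : prime_ideal m := local_prime noeR locR.
Local Notation zeroM := (@zero_sub R M).
Local Notation annM := (ann_quot zeroM).

Definition tail_bideal x j : R -> Prop := bideal m (sub_gen zeroM (drop j.+1 x)).

Lemma tail_bideal_ideal x j : ideal (tail_bideal x j).
Proof. exact: bideal_ideal. Qed.

(* The entries of [z] can replace the first entries of [x] without changing the index of
   reducibility, and they are parameters modulo each ideal [tail_bideal x j] with
   [size z <= j]. *)
Definition exchanged x z : Prop :=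
  [/\ forall j, (size z <= j < size x)%N ->
        dim_leq (adjoinI (tail_bideal x j) z) (j - size z),
      dim_leq (adjoinI annM (z ++ drop (size z) x)) 0 &
      forall n, @ir_is R M m x n <-> @ir_is R M m (z ++ drop (size z) x) n].

Lemma exchanged_nil x : @c_sop R M m x -> exchanged x [::].
Proof.
move=> [[_ mx fin_x] cube_x].
have dim_x := finite_length_dim0 noeR locR fgM zero_submodule fin_x.
split=> [j /andP[_ lt_j]||n]; rewrite ?drop0 // subn0.
rewrite -[X in dim_leq _ X](size_takel (ltnW lt_j)) -[size _]add0n.
apply: (dim_leq_adjoin_seq noeR locR).
  by move=> a /mem_take /(nthP 0)[k lt_k <-]; apply: mx.
apply: dim_leq_over dim_x => P _ /adjoinI_subP[/adjoinI_subP[BP _] take_P].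
have tail_P : subI (ann_quot (sub_gen zeroM (drop j.+1 x))) P.
  by move=> a a_tail; apply: BP; apply: ann_quot_bideal.
apply/adjoinI_subP; split=> [a aM|a].
  by apply: tail_P => v; apply: sub_gen_sub; apply: aM.
rewrite -{1}(cat_take_drop j x) mem_cat (drop_nth 0) // inE.
case/or3P=> [/take_P//|/eqP->|ax].
  by apply: BP; apply: ideal_cube_sub (cube_x j lt_j); apply: bideal_ideal.
by apply: tail_P => v; apply: sub_gen_mem.
Qed.

(* The [A] for which [dim (R / A)] has to drop when the next parameter is adjoined to [z]. *)
Definition exchange_loci x z : seq (R -> Prop) :=
  adjoinI annM (z ++ drop (size z).+1 x) ::
  [seq adjoinI (tail_bideal x j) z | j <- iota (size z).+1 (size x - (size z).+1)].

Lemma exchange_loci_sub x z A : A \in exchange_loci x z -> forall a, a \in z -> A a.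
Proof.
rewrite inE => /predU1P[->|/mapP[j _ ->]] a az; right => //.
by rewrite mem_cat az.
Qed.

Section ExchangeStep.
Variables x z : seq R.
Hypotheses (cx : @c_sop R M m x) (mz : forall a, a \in z -> m a).
Hypotheses (exch : exchanged x z) (lt_zx : (size z < size x)%N).
Local Notation i := (size z).

Let mx a : a \in x -> m a.
Proof. by case: cx => [[_ mx _] _] /(nthP 0)[j lt_j <-]; apply: mx. Qed.

Let drop_x : drop i x = x`_i :: drop i.+1 x := drop_nth 0 lt_zx.

Let m_tail a : a \in z ++ drop i.+1 x -> m a.
Proof. by rewrite mem_cat => /orP[/mz|/mem_drop /mx]. Qed.

Lemma ideal_prod_tail_bideal_not_sub P : prime_ideal P -> (forall a, a \in z -> P a) ->
  ~ subI m P -> ~ subI (ideal_prod m (tail_bideal x i)) P.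
Proof.
move=> prP zP nmP; have [dim_z _ _] := exch.
have nBP : ~ subI (tail_bideal x i) P.
  move=> BP; apply: nmP.
  have := dim_z i; rewrite leqnn lt_zx subnn => /(_ isT) /(dim_leq0P noeR locR).
  by apply=> //; apply/adjoinI_subP.
exact: ideal_prod_not_sub_prime.
Qed.

Lemma exchanged_rcons u : ideal_prod m (tail_bideal x i) u ->
  (forall A, A \in exchange_loci x z -> forall n,
     dim_leq A n.+1 -> dim_leq (adjoinI A [:: u]) n) ->
  exchanged x (rcons z u).
Proof.
move=> mBu dim_u; have [dim_z dim_zx ir_zx] := exch.
have [[dimM _ _] cube_x] := cx.
have dim_tail : dim_leq (adjoinI annM (z ++ drop i.+1 x)) 1.
  apply: (@dim_leq_adjoin_seq _ m noeR locR _ [:: x`_i] 0) => [a|].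
    by rewrite inE => /eqP->; apply/mx/mem_nth.
  by rewrite adjoinI_cat cats1 -(eq_mem_adjoinI _ (mem_insert _ _ _)) -drop_x.
have dim_zu : dim_leq (adjoinI annM (z ++ u :: drop i.+1 x)) 0.
  rewrite (eq_mem_adjoinI _ (mem_insert _ _ _)) -cats1 -adjoinI_cat.
  exact: dim_u (mem_head _ _) _ dim_tail.
split=> [j||]; rewrite ?size_rcons ?cat_rcons //.
- move=> /andP[lt_ij lt_jx]; rewrite -cats1 -adjoinI_cat; apply: dim_u.
    rewrite inE; apply/orP; right; apply: (map_f (fun j => adjoinI (tail_bideal x j) z)).
    by rewrite mem_iota lt_ij subnKC.
  by rewrite -subSn // subSS; apply: dim_z; rewrite ltnW.
- have xi_B := ideal_cube_local_prod noeR locR (tail_bideal_ideal x i)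
    (mx (mem_nth 0 lt_zx)) (cube_x i lt_zx).
  have dimM' : module_dim zeroM (i + size (drop i.+1 x)).+1.
    by rewrite size_drop -addSn subnKC.
  move=> n; rewrite ir_zx /ir_is drop_x; rewrite drop_x in dim_zx.
  have exchange := socle_kdim_parameter_exchange noeR locR fgM zero_submodule dimM' m_tail.
  by split; apply: exchange.
Qed.

End ExchangeStep.

Lemma common_exchange (X : seq (seq R)) d i :
  (forall x, x \in X -> @c_sop R M m x /\ size x = d) -> (i <= d)%N ->
  exists z, [/\ size z = i, forall a, a \in z -> m a & forall x, x \in X -> exchanged x z].
Proof.
move=> cX; elim: i => [_|i IHi lt_id].
  by exists [::]; split=> // x /cX[cx _]; apply: exchanged_nil.
have [z [sz_z mz exch]] := IHi (ltnW lt_id).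
have lt_zx x : x \in X -> (size z < size x)%N by move=> /cX[_ ->]; rewrite sz_z.
pose Js := m :: [seq ideal_prod m (tail_bideal x (size z)) | x <- X].
have JsP J : J \in Js ->
    J = m \/ exists2 x, x \in X & J = ideal_prod m (tail_bideal x (size z)).
  by rewrite inE => /predU1P[|/mapP]; [left | right].
have iJs J : J \in Js -> ideal J.
  by move=> /JsP[->|[x _ ->]]; [case: prm | apply: ideal_prod_ideal].
have [A /flatten_mapP[x xX xA] P prP AP nmP|u Ju dim_u] := dim_avoidance
    (As := flatten [seq exchange_loci x z | x <- X]) noeR locR (bigcapI_ideal iJs).
  apply: bigcapI_not_sub_prime => // J inJ; split; first exact: iJs.
  case: (JsP J inJ) => [->//|[y yX ->]].
  apply: ideal_prod_tail_bideal_not_sub => //; [exact: exch | exact: lt_zx |].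
  by move=> a az; apply: AP; apply: exchange_loci_sub xA a az.
have mu : m u by apply: Ju; apply: mem_head.
exists (rcons z u); split=> [|a|x xX].
- by rewrite size_rcons sz_z.
- by rewrite mem_rcons inE => /predU1P[->|/mz].
have [cx _] := cX x xX.
apply: exchanged_rcons => //; [exact: exch | exact: lt_zx | |].
  by apply: Ju; rewrite inE; apply/orP; right; apply: map_f.
by move=> A xA; apply: dim_u; apply/flatten_mapP; exists x.
Qed.

End CSystems.

Theorem theorem3p2 (R : comNzRingType) (m : R -> Prop) (M : lmodType R)
  (d : nat) (x y : seq R) :
  noetherian R -> local_ring m -> cm_image R ->
  fin_gen M -> module_dim (@zero_sub R M) d -> (0 < d)%N ->
  @c_sop R M m x -> @c_sop R M m y ->
  forall n : nat, @ir_is R M m x n <-> @ir_is R M m y n.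
Proof.
move=> noeR locR _ fgM dimM _ cx cy n.
have size_c_sop w : @c_sop R M m w -> size w = d.
  by move=> [[dim_w _ _] _]; apply: chain_dim_unique dim_w dimM.
have [w|z [sz_z _ exch]] := common_exchange (X := [:: x; y]) noeR locR fgM _ (leqnn d).
  by rewrite !inE => /orP[/eqP->|/eqP->]; split=> //; apply: size_c_sop.
have ir_z w : w \in [:: x; y] -> @c_sop R M m w -> @ir_is R M m w n <-> @ir_is R M m z n.
  by move=> /exch[_ _ ->] /size_c_sop sz_w; rewrite drop_oversize ?cats0 // sz_z sz_w.
by rewrite !ir_z // !inE eqxx ?orbT.
Qed.
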